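(* Suppose data points lie on the unit half-circle $\{(\cos\theta,\sin\theta)\in\mathbb{R}^2 : \theta\in[-\pi/2,\pi/2]\}$ and are uniformly distributed on it, and there are two classes separated by the $x$-axis (points with $\theta>0$ form one class and points with $\theta<0$ the other). Let $\mathcal{T}_0$ be an initial labeled sample consisting of $m$ samples from each class, and let $\mathcal{Z}$ be a candidate set drawn from the same distribution. Let the learner $H$ be a linear SVM whose decision boundary passes through the origin. Suppose min-margin sampling is run with bootstrap sample size fraction $\beta\ge \frac{1}{m}$ and that its learned models $\{h_1,\dots,h_K\}$ span all possible models obtainable from a stratified bootstrap sample of $\mathcal{T}_0$. Suppose that $$|\mathcal{Z}|\ge 12B\cdot m,\qquad B\ge 3m^2\log(m),\qquad m\ge 100.$$ For $S\subseteq\mathcal{Z}$ define $\Theta^*(S):=\min\{\theta^2 : (\cos\theta,\sin\theta)\in S,\ \theta\in[-\pi/2,\pi/2]\}$, i.e. the squared angle (with respect to the positive $x$-axis) of the example of $S$ closest to the true decision boundary. Let $S_{\text{margin}},S_{\text{min-margin}}\subseteq\mathcal{Z}$ be the batches of size $B$ chosen by margin sampling and by min-margin sampling respectively. Then $$\mathbb{E}[\Theta^*(S_{\text{min-margin}})]<\mathbb{E}[\Theta^*(S_{\text{margin}})].$$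
   Context: Setting: a labeled training set $\mathcal{T}_0=\{(x_i,y_i)\}_{i=1}^N$ with $N_g$ examples of class $g$, a candidate set $\mathcal{Z}$, and a learning procedure $H$ that maps a training set $\mathcal{T}$ to a model $h=H(\mathcal{T})$ with class discriminant functions $h(z;g)$. The margin of $h$ at $z$ is $\mathrm{margin}(h,z)=h(z;\hat y_1(z))-h(z;\hat y_2(z))$, where $\hat y_1(z)=\arg\max_g h(z;g)$ and $\hat y_2(z)=\arg\max_{g\ne\hat y_1(z)}h(z;g)$. Margin sampling: train $h=H(\mathcal{T}_0)$ and return the $B$ candidates $z\in\mathcal{Z}$ with smallest $\mathrm{margin}(h,z)$. Min-margin sampling with parameters $K$ (number of bootstrap models) and $\beta$ (bootstrap sample size fraction): for each $k=1,\dots,K$, let $\mathcal{T}_k$ be a random sample with replacement from $\mathcal{T}_0$ consisting of $\lfloor\beta N_g\rfloor$ examples from each class $g$ (stratified bootstrap sample), and $h_k=H(\mathcal{T}_k)$; score each $z\in\mathcal{Z}$ by $\min_{k\in[K]}\mathrm{margin}(h_k,z)$ and return the $B$ candidates with lowest score. A linear SVM on linearly separable binary data learns a linear decision boundary (here constrained to pass through the origin) that correctly separates the two classes and maximizes the minimum distance of any training example to the boundary. Expectations are over the random draws of $\mathcal{T}_0$ and $\mathcal{Z}$. *)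

(* Defs.v *)
From HB Require Import structures.
From mathcomp Require Import all_boot all_order all_algebra.
From mathcomp Require Import all_classical all_reals all_analysis.
Set Implicit Arguments. Unset Strict Implicit. Unset Printing Implicit Defensive.
Import Order.TTheory GRing.Theory Num.Theory.
Local Open Scope ring_scope.

Section Defs.
Variable R : realType.

Definition pt2 := (R * R)%type.
Definition pt (t : R) : pt2 := (cos t, sin t).
Definition dot (w x : pt2) : R := w.1 * x.1 + w.2 * x.2.
Definition unitv (w : pt2) : Prop := w.1 ^+ 2 + w.2 ^+ 2 = 1.

(** Labeled training sets; label [true] = class {theta > 0},
    label [false] = class {theta < 0}. *)
Definition tset := seq (pt2 * bool).

(** A linear classifier through the origin with unit normal [w]: the
    discriminant of class g is the signed distance to the boundary. *)
Definition lin_disc (w : pt2) (z : pt2) (g : bool) : R :=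
  if g then dot w z else - dot w z.

Definition margin (h : pt2 -> bool -> R) (z : pt2) : R :=
  let y1 := if h z false <= h z true then true else false in
  h z y1 - h z (~~ y1).

Definition separates (w : pt2) (T : tset) : Prop :=
  forall p, p \in T -> if p.2 then 0 < dot w p.1 else dot w p.1 < 0.

(** minimum distance of a training example to the boundary {z | <w,z> = 0}
    (for unit w); only used for nonempty T. *)
Definition mindist (w : pt2) (T : tset) : R :=
  match T with
  | [::] => 0
  | p :: T' => foldr (fun q acc => Num.min `|dot w q.1| acc) `|dot w p.1| T'
  end.

Definition is_max_margin (T : tset) (w : pt2) : Prop :=
  [/\ unitv w, separates w T &
      forall v, unitv v -> separates v T -> mindist v T <= mindist w T].

Definition is_svm_learner (H : tset -> pt2) : Prop :=
  forall T : tset, has (fun p => p.2) T -> has (fun p => ~~ p.2) T ->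
    (exists w, unitv w /\ separates w T) -> is_max_margin T (H T).

(** Selection of the B candidates of lowest score (ties, a null event,
    broken by index). *)
Definition select_batch (n B : nat) (score : 'I_n -> \bar R) : {set 'I_n} :=
  [set i : 'I_n | (#|[set j : 'I_n | ((score j < score i)%E ||
                       ((score j == score i) && (j < i)%N))]| < B)%N].

Definition Theta_star (n : nat) (theta : 'I_n -> R) (S : {set 'I_n}) : \bar R :=
  (\big[mine/+oo]_(j in S) ((theta j) ^+ 2)%:E)%E.

Definition train0 (m : nat) (a b : 'I_m -> R) : tset :=
  [seq (pt (a i), true) | i <- enum 'I_m] ++ [seq (pt (b i), false) | i <- enum 'I_m].

Definition boot (m k : nat) (a b : 'I_m -> R)
  (s : {ffun 'I_k -> 'I_m} * {ffun 'I_k -> 'I_m}) : tset :=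
  [seq (pt (a (s.1 i)), true) | i <- enum 'I_k] ++
  [seq (pt (b (s.2 i)), false) | i <- enum 'I_k].

Definition margin_batch (H : tset -> pt2) (m n B : nat)
  (a b : 'I_m -> R) (theta : 'I_n -> R) : {set 'I_n} :=
  select_batch B (fun j => (margin (lin_disc (H (train0 a b))) (pt (theta j)))%:E).

(** Min-margin sampling batch, with bootstrap sample size k = floor(beta m)
    per class, the models ranging over ALL stratified bootstrap samples. *)
Definition minmargin_batch (H : tset -> pt2) (m k n B : nat)
  (a b : 'I_m -> R) (theta : 'I_n -> R) : {set 'I_n} :=
  select_batch B (fun j =>
    (\big[mine/+oo]_(s : {ffun 'I_k -> 'I_m} * {ffun 'I_k -> 'I_m})
        (margin (lin_disc (H (boot a b s))) (pt (theta j)))%:E)%E).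

Definition uniform_law d (Omega : measurableType d) (P : probability Omega R)
  (X : Omega -> R) (lo hi : R) : Prop :=
  measurable_fun setT%classic X /\
  forall A : set R, measurable A ->
    P (X @^-1` A)%classic = (lebesgue_measure (A `&` `[lo, hi])%classic * ((hi - lo)^-1)%:E)%E.

Definition mutually_independent d (Omega : measurableType d)
  (P : probability Omega R) (I : finType) (F : I -> Omega -> R) : Prop :=
  forall (J : {set I}) (A : I -> set R), (forall i, measurable (A i)) ->
    P (\bigcap_(i in [set` J]) (F i @^-1` A i))%classic =
    (\prod_(i in J) P (F i @^-1` A i)%classic)%E.

Definition join3 (T : Type) (m n : nat) (X Y : 'I_m -> T) (Z : 'I_n -> T) :
  'I_m + 'I_m + 'I_n -> T :=
  fun i => match i with inl (inl i) => X i | inl (inr i) => Y i | inr j => Z j end.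

End Defs.

(* Main.v *)
Require Import Defs.
From HB Require Import structures.
From mathcomp Require Import all_boot all_order all_algebra.
From mathcomp Require Import ring lra zify.
From mathcomp Require Import all_classical all_reals all_analysis measurable_realfun.
Import Order.TTheory GRing.Theory Num.Theory.
Set Implicit Arguments. Unset Strict Implicit. Unset Printing Implicit Defensive.
Local Open Scope ring_scope.

(** The SVM boundary is the angle c halfway between the smallest positive and
    the largest negative training angle, and the margin at angle t is
    2 |sin (t - c)|; over all bootstrap samples, c ranges over all the
    midpoints (a_i + b_j) / 2.

    Margin sampling returns points within about pi B / |Z| of c.  As this is
    small against the typical size of c, E[Theta^*] is at least about
    3/4 E[c^2], with E[c^2] close to 2 (pi / 4m)^2.

    Min-margin sampling is likely to return a point close to any given
    midpoint.  When [0, pi/2] is cut into 3m/2 bins, some a_i and -b_j share a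
    bin except with exponentially small probability, so that some midpoint has
    absolute value at most pi / (6m), and E[Theta^*] is at most about (4/9 + 2/5) (pi / 4m)^2.

    To condition on the training angles, they are rounded to a mesh so fine
    that all errors are negligible; given the mesh cell, the numbers of
    candidates in fixed sets are controlled by Markov's inequality for
    t^(number of candidates). *)

(** * Maximum-margin separators on the half-circle *)

Section Geometry.
Variable R : realType.
Implicit Types (T : tset R) (H : tset R -> pt2 R) (t c r x : R).

(** Unit normal of the line at angle c, pointing towards larger angles, the side of class [true]. *)
Definition normal_at (c : R) : pt2 R := (- sin c, cos c).

Lemma dot_normal c t : dot (normal_at c) (pt t) = sin (t - c).
Proof. by rewrite /dot /= sinB; ring. Qed.

Lemma unitv_normal c : unitv (normal_at c).
Proof. by rewrite /unitv /= sqrrN addrC cos2Dsin2. Qed.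

Lemma ler_sin : {in `[- (pi / 2), pi / 2] &, {mono (@sin R) : x y / x <= y}}.
Proof. by move=> x y xI yI; rewrite !leNgt ltr_sin. Qed.

Lemma margin_lin w z : margin (lin_disc w) z = `|dot w z| * 2 :> R.
Proof.
rewrite /margin /lin_disc.
have [h0|h0] := leP (- dot w z) (dot w z) => /=.
  by rewrite ger0_norm; [ring | lra].
by rewrite ltr0_norm; [ring | lra].
Qed.

Lemma mindist_geP w T c : T != [::] ->
  (forall p, p \in T -> c <= `|dot w p.1|) -> c <= mindist w T.
Proof.
case: T => [//|p T _] h /=.
have h0 : c <= `|dot w p.1| by apply: h; rewrite inE eqxx.
have {h} : forall q, q \in T -> c <= `|dot w q.1|.
  by move=> q qT; apply: h; rewrite inE qT orbT.
elim: T => [//|q T IH] h /=; rewrite le_min h ?inE ?eqxx //=.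
by apply: IH => q' q'T; apply: h; rewrite inE q'T orbT.
Qed.

Lemma mindist_le w T p : p \in T -> mindist w T <= `|dot w p.1|.
Proof.
case: T => [//|q T] /=; rewrite inE => /orP[/eqP->|].
  by elim: T => [//|q' T IH] /=; rewrite ge_min IH orbT.
elim: T => [//|q' T IH] /=; rewrite inE ge_min => /orP[/eqP->|/IH ->].
  by rewrite lexx.
by rewrite orbT.
Qed.

(* The difference of the two closest points is 2 sin g times the normal at
   their mean angle c, so a unit separator of margin at least sin g has inner
   product at least 1 with that normal. *)
Lemma svm_normal H T (a b : R) :
  is_svm_learner H ->
  (pt a, true) \in T -> (pt b, false) \in T ->
  0 < a -> a <= pi / 2 -> - (pi / 2) <= b -> b < 0 ->
  (forall p, p \in T -> exists2 t, p.1 = pt t &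
     if p.2 then a <= t <= pi / 2 else - (pi / 2) <= t <= b) ->
  H T = normal_at ((a + b) / 2).
Proof.
move=> svmH aT bT a0 api bpi b0 Tab.
set c := (a + b) / 2; set g := (a - b) / 2.
have g0 : 0 < g by rewrite /g; lra.
have gpi : g <= pi / 2 by rewrite /g; lra.
have pi0 := pi_gt0 R.
have sg0 : 0 < sin g by apply: sin_gt0_pi; rewrite g0 /=; lra.
have sin_ge x : g <= x -> x <= pi - g -> sin g <= sin x.
  move=> gx xg; have [x2|x2] := leP x (pi / 2).
    by rewrite ler_sin // in_itv /=; apply/andP; split; lra.
  have -> : sin x = sin (pi - x).
    by rewrite sinB sinpi cospi; ring.
  by rewrite ler_sin // ?in_itv /=; try (apply/andP; split); lra.
(* Seen from c, class [true] lies in [g, pi - g] and class [false] in [g - pi, - g]; the far ends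
   come from - pi/2 <= b and a <= pi/2. *)
have far p : p \in T -> if p.2 then sin g <= dot (normal_at c) p.1
    else dot (normal_at c) p.1 <= - sin g.
  move=> /Tab[t -> ]; rewrite dot_normal; case: p.2 => /andP[t1 t2].
    by apply: sin_ge; rewrite /g /c; lra.
  rewrite -(opprK (t - c)) sinN lerN2 opprB.
  by apply: sin_ge; rewrite /g /c; lra.
have sepc : separates (normal_at c) T.
  move=> p /far; case: p.2 => h; lra.
have T0 : T != [::] by case: (T) aT.
have mc : sin g <= mindist (normal_at c) T.
  apply: mindist_geP => // p /far; case: p.2 => h.
    by apply: (le_trans h); apply: ler_norm.
  by rewrite -normrN; apply: le_trans (ler_norm _); lra.
have hasT : has (fun p => p.2) T by apply/hasP; exists (pt a, true).
have hasF : has (fun p => ~~ p.2) T by apply/hasP; exists (pt b, false).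
have exw : exists w, unitv w /\ separates w T.
  by exists (normal_at c); split => //; exact: unitv_normal.
have [uw sw mw] := svmH T hasT hasF exw.
have dw := mw _ (unitv_normal c) sepc.
have dwa : sin g <= dot (H T) (pt a).
  rewrite -[leRHS]gtr0_norm; last exact: (sw _ aT).
  exact: le_trans (le_trans mc dw) (mindist_le _ aT).
have dwb : sin g <= - dot (H T) (pt b).
  rewrite -[leRHS]gtr0_norm; last by rewrite oppr_gt0; exact: (sw _ bT).
  rewrite normrN.
  exact: le_trans (le_trans mc dw) (mindist_le _ bT).
have : 1 <= dot (H T) (normal_at c).
  have ea : a = c + g by rewrite /c /g; field.
  have eb : b = c - g by rewrite /c /g; field.
  move: dwa dwb; rewrite ea eb /dot /= sinD cosD sinB cosB => h1 h2.
  have : 0 <= (dot (H T) (normal_at c) - 1) * sin g.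
    by rewrite /dot /=; lra.
  by rewrite pmulr_lge0 // subr_ge0.
have := unitv_normal c; move: uw.
rewrite /unitv /dot /normal_at; case: (H T) => u v /=.
move: (sin c) (cos c) => p q e1 e2 h.
(* For unit vectors the squared distance is 2 minus twice the inner product, hence at most 0
   here. *)
have : (u + p) ^+ 2 + (v - q) ^+ 2 <= 0 by nra.
have ge1 := sqr_ge0 (u + p); have ge2 := sqr_ge0 (v - q).
move=> le0.
have /eqP : (u + p) ^+ 2 = 0 by lra.
have /eqP : (v - q) ^+ 2 = 0 by lra.
rewrite !sqrf_eq0 subr_eq0 addr_eq0 => /eqP-> /eqP->.
by [].
Qed.

Lemma norm_sin_le x r : `|x| <= r -> r <= pi / 2 -> `|sin x| <= sin r.
Proof.
move=> xr rpi; have pi0 := pi_gt0 R; move: (xr); rewrite ler_norml => /andP[h1 h2].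
rewrite ler_norml -sinN.
by rewrite !ler_sin // ?in_itv /=; try (apply/andP; split); lra.
Qed.

(** Beyond pi/2 the sine decreases and comes back to sin r only at pi - r; up to there, comparing
    [|sin x|] with sin r is comparing [|x|] with r. *)
Lemma norm_sin_gt x r : 0 <= r -> r < `|x| -> `|x| < pi - r -> sin r < `|sin x|.
Proof.
move=> r0 rx xr; have pi0 := pi_gt0 R.
have -> : `|sin x| = sin `|x|.
  have sx : 0 <= sin `|x| by apply: sin_ge0_pi; rewrite normr_ge0 /=; lra.
  by rewrite -[RHS]ger0_norm //; case: (ger0P x) => // _; rewrite sinN normrN.
have [x2|x2] := leP `|x| (pi / 2).
  by rewrite ltr_sin // in_itv /=; apply/andP; split; lra.
have -> : sin `|x| = sin (pi - `|x|) by rewrite sinB sinpi cospi; ring.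
by rewrite ltr_sin // ?in_itv /=; try (apply/andP; split); lra.
Qed.

End Geometry.

(** * Batches as sets of candidates close to midpoints *)

Section Batches.
Variables (R : realType) (n B : nat).
Implicit Types (score : 'I_n -> \bar R) (theta : 'I_n -> R).

(** Among the candidates of least score, the one of least index has no predecessor. *)
Lemma select_batch_nonempty score : (0 < B)%N -> (0 < n)%N ->
  exists j, j \in select_batch B score.
Proof.
move=> B0 n0.
have [i1 _ i1min] := @arg_minP _ _ _ (Ordinal n0) xpredT score isT.
have [j jE jmin] := @arg_minnP _ i1 (fun i => score i == score i1) id (eqxx _).
exists j; rewrite inE; set S := [set _ | _].
suff -> : S = finset.set0 by rewrite cards0.
apply/setP => k; rewrite !inE (eqP jE).
rewrite ltNge i1min //=; have [kE|//] := eqVneq; have := jmin k; rewrite kE eqxx => /(_ isT).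
by rewrite leqNgt => /negbTE.
Qed.

(** The predecessors of j form a proper subset of the counted set, which contains j itself; ties are
    counted on the safe side. *)
Lemma select_batch_mem score j : (#|[set k | (score k <= score j)%E]| <= B)%N ->
  j \in select_batch B score.
Proof.
move=> h; rewrite inE; apply: leq_trans h; apply: proper_card.
apply/properP; split.
  apply/fintype.subsetP => k; rewrite !inE => /orP[/ltW//|/andP[/eqP-> _]].
  exact: lexx.
by exists j; rewrite !inE ?lexx // ltxx ltnn andbF.
Qed.

(** All of Q precedes any l outside Q, so such an l has at least B predecessors. *)
Lemma select_batch_sub score (Q : {set 'I_n}) : (B <= #|Q|)%N ->
  (forall k l, k \in Q -> l \notin Q -> (score k < score l)%E) ->
  select_batch B score \subset Q.
Proof.
move=> BQ QQ; apply/fintype.subsetP => l; rewrite inE; apply: contraTT => lQ.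
rewrite -leqNgt; apply: (leq_trans BQ); apply: subset_leq_card.
by apply/fintype.subsetP => k kQ; rewrite inE QQ.
Qed.

Lemma Theta_star_le theta (S : {set 'I_n}) j : j \in S ->
  (Theta_star theta S <= (theta j ^+ 2)%:E)%E.
Proof. by move=> jS; apply: bigmin_le_cond. Qed.

Lemma Theta_star_ge theta (S : {set 'I_n}) (c : R) :
  (forall j, j \in S -> c <= theta j ^+ 2) -> (c%:E <= Theta_star theta S)%E.
Proof.
by move=> h; apply/bigmin_geP; split=> [|j /h]; rewrite ?leey ?lee_fin.
Qed.

Variables (m : nat) (a b : 'I_m -> R) (theta : 'I_n -> R) (H : tset R -> pt2 R).
Hypothesis svmH : is_svm_learner H.
Hypothesis a_gt0 : forall i, 0 < a i.
Hypothesis a_le : forall i, a i <= pi / 2.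
Hypothesis b_ge : forall i, - (pi / 2) <= b i.
Hypothesis b_lt0 : forall i, b i < 0.
Hypothesis theta_le : forall j, `|theta j| <= pi / 2.

Lemma train0_normal i0 i1 : (forall i, a i0 <= a i) -> (forall i, b i <= b i1) ->
  H (train0 a b) = normal_at ((a i0 + b i1) / 2).
Proof.
move=> ai0 bi1; apply: svm_normal => //.
- by rewrite mem_cat; apply/orP; left; apply/mapP; exists i0; rewrite ?mem_enum.
- by rewrite mem_cat; apply/orP; right; apply/mapP; exists i1; rewrite ?mem_enum.
- move=> p; rewrite mem_cat => /orP[] /mapP[i _ ->] /=.
    by exists (a i) => //; rewrite ai0 a_le.
  by exists (b i) => //; rewrite bi1 b_ge.
Qed.

Lemma boot_normal k (s : {ffun 'I_k -> 'I_m} * {ffun 'I_k -> 'I_m}) : (0 < k)%N ->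
  exists i i', H (boot a b s) = normal_at ((a i + b i') / 2).
Proof.
move=> k0.
have [i0 _ i0m] := @arg_minP _ _ _ (Ordinal k0) xpredT (fun i => a (s.1 i)) isT.
have [i1 _ i1m] := @arg_maxP _ _ _ (Ordinal k0) xpredT (fun i => b (s.2 i)) isT.
exists (s.1 i0), (s.2 i1); apply: svm_normal => //.
- by rewrite mem_cat; apply/orP; left; apply/mapP; exists i0; rewrite ?mem_enum.
- by rewrite mem_cat; apply/orP; right; apply/mapP; exists i1; rewrite ?mem_enum.
- move=> p; rewrite mem_cat => /orP[] /mapP[i _ ->] /=.
    by exists (a (s.1 i)) => //; rewrite a_le andbT i0m.
  by exists (b (s.2 i)) => //; rewrite b_ge; apply: i1m.
Qed.

(** Repeating a single example of each class is a legitimate bootstrap sample, so every midpoint is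
    attained as soon as k > 0. *)
Lemma boot_const_normal k i i' : (0 < k)%N ->
  H (boot a b ([ffun _ : 'I_k => i], [ffun _ : 'I_k => i'])) =
  normal_at ((a i + b i') / 2).
Proof.
move=> k0; apply: svm_normal => //.
- rewrite mem_cat; apply/orP; left; apply/mapP.
  by exists (Ordinal k0); rewrite ?mem_enum //= ffunE.
- rewrite mem_cat; apply/orP; right; apply/mapP.
  by exists (Ordinal k0); rewrite ?mem_enum //= ffunE.
- move=> p; rewrite mem_cat => /orP[] /mapP[j _ ->] /=; rewrite ffunE.
    by exists (a i) => //; rewrite a_le lexx.
  by exists (b i') => //; rewrite b_ge lexx.
Qed.

(** Midpoints lie within pi/4 of 0, so the difference is below 3 pi/4; this is the range condition
    of [norm_sin_gt]. *)
Lemma angle_diff_lt i i' r j : r < pi / 4 ->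
  `|theta j - (a i + b i') / 2| < pi - r.
Proof.
move=> rpi; have pi0 := pi_gt0 R.
move: (a_gt0 i) (a_le i) (b_ge i') (b_lt0 i') (theta_le j).
by rewrite ler_norml ltr_norml => ? ? ? ? /andP[? ?]; apply/andP; split; lra.
Qed.

(** The value 2 sin r separates the scores: j scores at most this, and a candidate farther than r
    from every midpoint scores more. Hence only candidates in the counted set can compete with j. *)
Lemma minmargin_mem k i i' r j : (0 < k)%N -> r < pi / 4 ->
  `|theta j - (a i + b i') / 2| <= r ->
  (#|[set l | [exists u, exists v, (`|theta l - (a u + b v) / 2| <= r)%R]]| <= B)%N ->
  j \in minmargin_batch H k B a b theta.
Proof.
move=> k0 rpi jr cardB; apply: select_batch_mem; apply: leq_trans cardB.
have r0 : 0 <= r by apply: le_trans jr; apply: normr_ge0.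
have pi0 := pi_gt0 R.
apply: subset_leq_card; apply/fintype.subsetP => l; rewrite !inE.
apply: contraTT => /existsPn lr; rewrite -ltNge.
apply: (@le_lt_trans _ _ (sin r * 2)%:E).
  apply: (@bigmin_inf _ _ _ _ ([ffun => i], [ffun => i'])) => //.
  rewrite lee_fin margin_lin boot_const_normal // dot_normal ler_pM2r //.
  by apply: norm_sin_le => //; lra.
apply: lt_bigmin; first by rewrite ltry.
move=> s _; have [u [v ->]] := boot_normal s k0.
rewrite lte_fin margin_lin dot_normal ltr_pM2r //.
apply: norm_sin_gt => //; last exact: angle_diff_lt.
by have /existsPn /(_ v) := lr u; rewrite -ltNge.
Qed.

Lemma margin_batch_sub i0 i1 r : (forall i, a i0 <= a i) -> (forall i, b i <= b i1) ->
  0 <= r -> r < pi / 4 ->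
  (B <= #|[set l | (`|theta l - (a i0 + b i1) / 2| <= r)%R]|)%N ->
  margin_batch H B a b theta \subset
    [set l | (`|theta l - (a i0 + b i1) / 2| <= r)%R].
Proof.
move=> ai0 bi1 r0 rpi cardB; apply: select_batch_sub => // k l.
have pi0 := pi_gt0 R.
rewrite !inE -ltNge lte_fin !margin_lin (train0_normal ai0 bi1) !dot_normal => kr lr.
rewrite ltr_pM2r //; apply: le_lt_trans (norm_sin_gt r0 lr _).
  by apply: norm_sin_le => //; lra.
exact: angle_diff_lt.
Qed.

End Batches.

(** * Stability of both batches under rounding of the training angles *)

Section Perturbation.
Variables (R : realType) (n B m : nat).
Variables (a b : 'I_m -> R) (theta : 'I_n -> R) (H : tset R -> pt2 R).
Hypothesis svmH : is_svm_learner H.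
Hypothesis a_gt0 : forall i, 0 < a i.
Hypothesis a_le : forall i, a i <= pi / 2.
Hypothesis b_ge : forall i, - (pi / 2) <= b i.
Hypothesis b_lt0 : forall i, b i < 0.
Hypothesis theta_le : forall j, `|theta j| <= pi / 2.
Variables (a' b' : 'I_m -> R) (e : R).
Hypothesis aa' : forall i, `|a i - a' i| <= e.
Hypothesis bb' : forall i, `|b i - b' i| <= e.

(** True and rounded midpoints differ by at most e. Candidate j is within r + e of a true midpoint,
    and whatever is that close to a true midpoint is within r + 2e of a rounded one. *)
Lemma minmargin_Theta_le k i i' r g j : (0 < k)%N -> r + e < pi / 4 ->
  `|theta j - (a' i + b' i') / 2| <= r -> `|(a' i + b' i') / 2| <= g ->
  (#|[set l | [exists u, exists v,
      (`|theta l - (a' u + b' v) / 2| <= r + e * 2)%R]]| <= B)%N ->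
  (Theta_star theta (minmargin_batch H k B a b theta) <= ((g + r) ^+ 2)%:E)%E.
Proof.
move=> k0 rpi jr cg cardB.
apply: (@le_trans _ _ (theta j ^+ 2)%:E).
  have jr' : `|theta j - (a i + b i') / 2| <= r + e.
    move: (aa' i) (bb' i') jr; rewrite !ler_norml.
    by move=> /andP[? ?] /andP[? ?] /andP[? ?]; apply/andP; split; lra.
  apply: Theta_star_le; apply: (minmargin_mem svmH _ _ _ _ _ k0 rpi jr') => //.
  apply: leq_trans cardB; apply: subset_leq_card; apply/fintype.subsetP => l.
  rewrite !inE => /existsP[u /existsP[v]] lr; apply/existsP; exists u.
  apply/existsP; exists v.
  move: (aa' u) (bb' v) lr; rewrite !ler_norml.
  by move=> /andP[? ?] /andP[? ?] /andP[? ?]; apply/andP; split; lra.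
rewrite lee_fin -real_normK ?num_real // lerXn2r ?nnegrE //.
  by rewrite addr_ge0 // ?(le_trans _ jr) // (le_trans _ cg).
move: jr cg; rewrite !ler_norml.
by move=> /andP[? ?] /andP[? ?]; apply/andP; split; lra.
Qed.

Lemma Theta_minmargin_le k : (0 < k)%N -> (0 < B)%N -> (0 < n)%N ->
  (Theta_star theta (minmargin_batch H k B a b theta) <= ((pi / 2) ^+ 2)%:E)%E.
Proof.
move=> k0 B0 n0; have [j jS] := @select_batch_nonempty R n B
  (fun j => (\big[mine/+oo]_(s : {ffun 'I_k -> 'I_m} * {ffun 'I_k -> 'I_m})
        (margin (lin_disc (H (boot a b s))) (pt (theta j)))%:E)%E) B0 n0.
apply: le_trans (Theta_star_le _ jS) _.
rewrite lee_fin -real_normK ?num_real // lerXn2r ?nnegrE //.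
by have := pi_gt0 R; lra.
Qed.

Lemma margin_Theta_ge i0 i1 r : (forall i, a' i0 <= a' i) ->
  (forall i, b' i <= b' i1) -> 0 <= r -> r + e < pi / 4 ->
  (B <= #|[set l | (`|theta l - (a' i0 + b' i1) / 2| <= r)%R]|)%N ->
  (((3 / 4) * ((a' i0 + b' i1) / 2) ^+ 2 - 3 * (r + e * 2) ^+ 2)%:E <=
    Theta_star theta (margin_batch H B a b theta))%E.
Proof.
move=> ai0 bi1 r0 rpi cardB.
have e0 : 0 <= e by apply: le_trans (aa' i0).
have [j0 _ j0m] := @arg_minP _ _ _ i0 xpredT a isT.
have [j1 _ j1m] := @arg_maxP _ _ _ i1 xpredT b isT.
(* The extreme indices may change under rounding, but the minima and maxima themselves move by at
   most e. *)
have close : `|(a j0 + b j1) / 2 - (a' i0 + b' i1) / 2| <= e.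
  have := ai0 j0; have := bi1 j1; have := j0m i0 isT; have := j1m i1 isT.
  move: (aa' i0) (bb' i1) (aa' j0) (bb' j1); rewrite !ler_norml.
  move=> /andP[? ?] /andP[? ?] /andP[? ?] /andP[? ?] /= ? ? ? ?.
  by apply/andP; split; lra.
have sub : margin_batch H B a b theta \subset
    [set l | (`|theta l - (a j0 + b j1) / 2| <= r + e)%R].
  apply: margin_batch_sub => //.
  - by move=> i; apply: j0m.
  - by move=> i; apply: j1m.
  - by rewrite addr_ge0.
  apply: (leq_trans cardB); apply: subset_leq_card; apply/fintype.subsetP => l.
  rewrite !inE; move: close; rewrite !ler_norml.
  by move=> /andP[? ?] /andP[? ?]; apply/andP; split; lra.
apply: Theta_star_ge => j /(fintype.subsetP sub); rewrite inE.
move: close; set c := (a' i0 + b' i1) / 2; set c2 := (a j0 + b j1) / 2.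
set x := theta j; rewrite !ler_norml => /andP[h1 h2] /andP[h3 h4].
(* (|c| - s)^2 >= 3/4 c^2 - 3 s^2 *)
set s := r + e * 2.
have : (x - c) ^+ 2 <= s ^+ 2.
  rewrite -real_normK ?num_real // lerXn2r ?nnegrE //; first by rewrite /s; lra.
  by rewrite ler_norml; apply/andP; split; rewrite /s; lra.
move: s => s hs.
(* With y = c - x, the difference x^2 - 3/4 c^2 + 3 y^2 equals (c - 4y)^2 / 4. *)
have : 0 <= (c - 4 * (c - x)) ^+ 2 by apply: sqr_ge0.
nra.
Qed.

End Perturbation.

(** * Integrals bounded by weighted sums of probabilities *)

Section Measures.
Context d (Omega : measurableType d) (R : realType) (P : probability Omega R).
Implicit Types (f g : Omega -> \bar R) (E : set Omega).
Local Open Scope classical_set_scope.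

Definition prob E : R := fine (P E).

Lemma probK E : measurable E -> (prob E)%:E = P E.
Proof. by move=> mE; rewrite /prob fineK // fin_num_measure. Qed.

Lemma prob_ge0 E : 0 <= prob E.
Proof. exact/fine_ge0. Qed.

Lemma prob_setD E E' : measurable E -> measurable E' ->
  prob E <= prob (E `&` E') + prob (E `\` E').
Proof.
move=> mE mE'; rewrite -lee_fin EFinD !probK //; try by [apply: measurableI|apply: measurableD].
by rewrite -[X in (P X <= _)%E](setUIDK E E') measureU //;
   [apply: measurableI|apply: measurableD|rewrite setDE setIACA setICr setI0].
Qed.

(* The integral of a nonnegative function, measurable or not, is defined as a
   supremum over the simple functions below it. *)
Lemma le_integral_ge0 f g : (forall x, 0 <= f x)%E -> (forall x, f x <= g x)%E ->
  (\int[P]_x f x <= \int[P]_x g x)%E.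
Proof.
move=> f0 fg.
rewrite ge0_integralTE // ge0_integralTE; last first.
  by move=> x; apply: le_trans (f0 x) (fg x).
apply: ereal_sup_le => _ [h hf <-]; exists h => // x.
exact: le_trans (hf x) (fg x).
Qed.

Lemma integral_weighted_indic (I : finType) (c : I -> R) (E : I -> set Omega) :
  (forall i, 0 <= c i) -> (forall i, measurable (E i)) ->
  (\int[P]_x (\sum_i (c i * \1_(E i) x)%:E) = (\sum_i c i * prob (E i))%:E)%E.
Proof.
move=> c0 mE; rewrite ge0_integral_sum //; last 2 first.
- by move=> i; apply/measurable_EFinP; apply: measurable_funM.
- by move=> i x _; rewrite lee_fin mulr_ge0.
rewrite -sumEFin; apply: eq_bigr => i _.
under eq_integral do rewrite EFinM.
rewrite ge0_integralZl_EFin //; last exact/measurable_EFinP.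
by rewrite integral_indic // setIT EFinM probK.
Qed.

Lemma integral_ge_sum (I : finType) (c : I -> R) (E : I -> set Omega) f :
  (forall i, 0 <= c i) -> (forall i, measurable (E i)) ->
  (forall x, (\sum_i c i * \1_(E i) x)%:E <= f x)%E ->
  ((\sum_i c i * prob (E i))%:E <= \int[P]_x f x)%E.
Proof.
move=> c0 mE cf; rewrite -integral_weighted_indic //.
apply: le_integral_ge0 => x; last by rewrite sumEFin.
by rewrite sumEFin lee_fin sumr_ge0 // => i _; rewrite mulr_ge0.
Qed.

Lemma integral_le_sum (I : finType) (c : I -> R) (E : I -> set Omega)
    (N : set Omega) f :
  (forall i, 0 <= c i) -> (forall i, measurable (E i)) ->
  measurable N -> P N = 0%E -> (forall x, 0 <= f x)%E ->
  (forall x, ~ N x -> f x <= (\sum_i c i * \1_(E i) x)%:E)%E ->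
  (\int[P]_x f x <= (\sum_i c i * prob (E i))%:E)%E.
Proof.
move=> c0 mE mN N0 f0 fc; rewrite -integral_weighted_indic //.
have s0 x : (0 <= \sum_i (c i * \1_(E i) x)%:E)%E.
  by rewrite sumEFin lee_fin sumr_ge0 // => i _; rewrite mulr_ge0.
have ms : measurable_fun setT (fun x => \sum_i (c i * \1_(E i) x)%:E)%E.
  apply: emeasurable_sum => i; apply/measurable_EFinP.
  exact: measurable_funM.
(* Raised to +oo on the null set N, the simple function dominates f everywhere, and its integral
   stays the same. *)
pose h x := (\sum_i (c i * \1_(E i) x)%:E + +oo * (\1_N x)%:E)%E.
have mh : measurable_fun setT h.
  apply: emeasurable_funD => //; apply: measurable_funeM.
  exact/measurable_EFinP.
have h0 x : (0 <= h x)%E by rewrite adde_ge0 // mule_ge0 // lee_fin.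
apply: (@le_trans _ _ (\int[P]_x h x)%E).
  apply: le_integral_ge0 => // x; rewrite /h indicE.
  have [/set_mem xN|/negP xN] := boolP (x \in N).
    by rewrite mule1 addey ?leey // gt_eqF // (lt_le_trans _ (s0 x)) ?ltNy0.
  rewrite mule0 adde0 sumEFin; apply: fc => xN'; apply: xN.
  exact/mem_set.
rewrite (ge0_negligible_integral mN) // [leRHS](ge0_negligible_integral mN) //.
rewrite le_eqVlt; apply/orP; left; apply/eqP; apply: eq_integral => x.
rewrite inE => -[_ /= xN]; rewrite /h indicE.
by rewrite memNset // mule0 adde0.
Qed.

Lemma prob_exists_le (I : finType) (Q : pred I) (E : I -> set Omega) :
  (forall i, Q i -> measurable (E i)) ->
  measurable [set w | exists2 i, Q i & E i w] /\
  prob [set w | exists2 i, Q i & E i w] <= \sum_(i | Q i) prob (E i).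
Proof.
move=> mE.
have -> : [set w | exists2 i, Q i & E i w] = \big[setU/set0]_(i | Q i) E i.
  rewrite -bigcup_seq_cond; apply/seteqP; split=> w /= [i Qi Ei]; exists i => //=.
    by rewrite mem_index_enum.
  by move: Qi => /= /andP[].
elim/big_rec2: _ => [|i x A Qi [mA IH]]; first by rewrite /prob measure0.
have mU : measurable (E i `|` A) by apply: measurableU => //; apply: mE.
split => //.
rewrite -lee_fin EFinD !probK //; last exact: mE.
apply: (@le_trans _ _ (P (E i) + P A)%E); first by apply: measureU2 => //; apply: mE.
by rewrite leeD2l // -probK // lee_fin.
Qed.

End Measures.

(** * Product events and counts of candidates *)

Section IndependentSamples.
Context d (Omega : measurableType d) (R : realType) (P : probability Omega R).
Variables (m n : nat) (X Y : 'I_m -> Omega -> R) (Z : 'I_n -> Omega -> R).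
Hypothesis mX : forall i, measurable_fun setT (X i).
Hypothesis mY : forall i, measurable_fun setT (Y i).
Hypothesis mZ : forall j, measurable_fun setT (Z j).
Hypothesis indep : mutually_independent P (join3 X Y Z).
Local Open Scope classical_set_scope.

(** Product events, on which independence factors the probability. *)
Definition cyl (A A' : 'I_m -> set R) (C : 'I_n -> set R) : set Omega :=
  [set w | [/\ forall i, A i (X i w), forall i, A' i (Y i w) & forall j, C j (Z j w)]].

Lemma measurable_preim (f : Omega -> R) A : measurable_fun setT f ->
  measurable A -> measurable (f @^-1` A).
Proof. by move=> mf mA; rewrite -[X in measurable X]setTI; apply: mf. Qed.

Let G (A A' : 'I_m -> set R) (C : 'I_n -> set R) : 'I_m + 'I_m + 'I_n -> set R :=
  fun u => match u with inl (inl i) => A i | inl (inr i) => A' i | inr j => C j end.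

Lemma cylE A A' C :
  cyl A A' C = \bigcap_(u in [set` [set: 'I_m + 'I_m + 'I_n]%SET])
    (join3 X Y Z u @^-1` G A A' C u).
Proof.
apply/seteqP; split=> w /=.
  by move=> [h1 h2 h3] [[i|i]|j] _ /=.
by move=> h; split=> i; [apply: (h (inl (inl i)))|apply: (h (inl (inr i)))|apply: (h (inr i))];
  rewrite /= inE.
Qed.

Lemma measurable_cyl A A' C : (forall i, measurable (A i)) ->
  (forall i, measurable (A' i)) -> (forall j, measurable (C j)) ->
  measurable (cyl A A' C).
Proof.
move=> mA mA' mC; rewrite cylE; apply: fin_bigcap_measurable => //.
by move=> [[i|i]|j] _ /=; apply: measurable_preim.
Qed.

Lemma prob_cyl A A' C : (forall i, measurable (A i)) ->
  (forall i, measurable (A' i)) -> (forall j, measurable (C j)) ->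
  prob P (cyl A A' C) = (\prod_i prob P (X i @^-1` A i)) *
    (\prod_i prob P (Y i @^-1` A' i)) * \prod_j prob P (Z j @^-1` C j).
Proof.
move=> mA mA' mC; apply: EFin_inj; rewrite probK; last exact: measurable_cyl.
rewrite cylE indep; last by case=> [[i|i]|j] /=.
rewrite big_sumType /= big_sumType /= !EFinM -!prodEFin.
by congr (_ * _ * _)%E; apply: eq_big => [i|i _]; rewrite ?inE // probK //;
  apply: measurable_preim.
Qed.

(* Markov's inequality for t ^ (number of Z_j in C). *)
Lemma prob_count_le (A A' : 'I_m -> set R) (C : set R) (p t c : R) (Q : pred nat) :
  (forall i, measurable (A i)) -> (forall i, measurable (A' i)) -> measurable C ->
  (forall j, P (Z j @^-1` C) = p%:E) -> 0 <= t -> (forall k, Q k -> c <= t ^+ k) ->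
  let Bad := [set w | Q #|[set j | Z j w \in C]%SET|] in
  measurable (cyl A A' (fun=> setT) `&` Bad) /\
  prob P (cyl A A' (fun=> setT) `&` Bad) * c <=
    prob P (cyl A A' (fun=> setT)) * (1 - p + t * p) ^+ n.
Proof.
move=> mA mA' mC pC t0 ctk Bad.
pose CJ (J : {set 'I_n}) := fun j => if j \in J then C else ~` C.
have mCJ J j : measurable (CJ J j) by rewrite /CJ; case: ifP => _ //; apply: measurableC.
have pCE j : prob P (Z j @^-1` C) = p by rewrite /prob pC.
(* An index is taken as argument because n may be 0, and then p is unconstrained. *)
have p0 (j : 'I_n) : 0 <= p by rewrite -(pCE j) prob_ge0.
(* The complementary bound, used for the weight 1 - p of a candidate outside C. *)
have p1 (j : 'I_n) : p <= 1.
  by rewrite -lee_fin -(pC j); apply: probability_le1; apply: measurable_preim.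
have pCJ J j : prob P (Z j @^-1` CJ J j) = if j \in J then p else 1 - p.
  rewrite /CJ; case: ifP => _; first exact: pCE.
  rewrite /prob preimage_setC probability_setC; last exact: measurable_preim.
  by rewrite pC.
(* The event is split by the exact set J of candidates that fall in C; each piece is a product
   event. *)
have eqU : cyl A A' (fun=> setT) `&` Bad =
    [set w | exists2 J : {set 'I_n}, Q #|J| & cyl A A' (CJ J) w].
  apply/seteqP; split=> w /=.
    move=> [[h1 h2 _] QN]; exists [set j | Z j w \in C]%SET => //; split=> // j.
    by rewrite /CJ inE; case: ifP => [/set_mem//|/negP h Cj]; apply: h; apply/mem_set.
  move=> [J QJ [h1 h2 h3]]; split => //; rewrite /Bad /=.
  suff -> : [set j | Z j w \in C]%SET = J by [].
  apply/setP => j; rewrite inE; have := h3 j; rewrite /CJ.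
  case: ifP => _ h; first exact/mem_set.
  by apply/negP => /set_mem.
have [mU leU] := @prob_exists_le _ _ _ P _ (fun J : {set 'I_n} => Q #|J|)
  (fun J => cyl A A' (CJ J)) (fun J _ => measurable_cyl mA mA' (mCJ J)).
rewrite eqU; split => //.
have prodJ (J : {set 'I_n}) : \prod_j (if j \in J then t * p else 1 - p) =
    t ^+ #|J| * \prod_j (if j \in J then p else 1 - p).
  rewrite [LHS](bigID (mem J)) /= [in RHS](bigID (mem J)) /= mulrA; congr (_ * _).
    rewrite -prodr_const -big_split /=.
    by apply: eq_bigr => j ->.
  by apply: eq_bigr => j /negbTE ->.
pose K := (\prod_i prob P (X i @^-1` A i)) * (\prod_i prob P (Y i @^-1` A' i)).
have K0 : 0 <= K by rewrite mulr_ge0 // prodr_ge0 // => i _; rewrite prob_ge0.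
have -> : prob P (cyl A A' (fun=> setT)) = K.
  rewrite prob_cyl // [X in _ * X]big1 ?mulr1 // => j _.
  by rewrite preimage_setT /prob probability_setT.
have w0 (J : {set 'I_n}) : 0 <= \prod_j (if j \in J then p else 1 - p).
  by apply: prodr_ge0 => j _; case: ifP => _; rewrite ?p0 // subr_ge0 p1.
have cylJ J : prob P (cyl A A' (CJ J)) = K * \prod_j (if j \in J then p else 1 - p).
  by rewrite prob_cyl //; congr (_ * _); apply: eq_bigr => j _; rewrite pCJ.
(* Expanding the n factors over subsets J gives the expectation of t to the number of candidates in
   C. *)
have -> : (1 - p + t * p) ^+ n =
    \sum_(J : {set 'I_n}) t ^+ #|J| * \prod_j (if j \in J then p else 1 - p).
  under [RHS]eq_bigr do rewrite -prodJ.
  transitivity (\prod_(j < n) (t * p + (1 - p))).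
    by rewrite prodr_const card_ord addrC.
  by rewrite bigA_distr; apply: eq_bigl => J; rewrite inE.
have [c0|c0] := leP c 0.
  apply: (@le_trans _ _ 0); first by rewrite mulr_ge0_le0 // prob_ge0.
  apply: mulr_ge0 => //; apply: sumr_ge0 => J _.
  by apply: mulr_ge0 => //; apply: exprn_ge0.
apply: (@le_trans _ _ (\sum_(J : {set 'I_n} | Q #|J|) prob P (cyl A A' (CJ J)) * c)).
  by rewrite -mulr_suml ler_pM2r.
rewrite mulr_sumr [leRHS](bigID (fun J : {set 'I_n} => Q #|J|)) /=.
rewrite -[leLHS]addr0 lerD //.
  apply: ler_sum => J QJ; rewrite cylJ mulrAC -mulrA ler_wpM2l //.
  by rewrite ler_wpM2r // ctk.
apply: sumr_ge0 => J _; apply: mulr_ge0 => //.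
by apply: mulr_ge0 => //; apply: exprn_ge0.
Qed.

End IndependentSamples.

(** * Intervals under a uniform law *)

Section UniformLaw.
Context d (Omega : measurableType d) (R : realType) (P : probability Omega R).
Variables (X : Omega -> R) (lo hi : R).
Hypothesis lohi : lo < hi.
Hypothesis unifX : uniform_law P X lo hi.
Local Open Scope classical_set_scope.

Lemma uniform_itv (u v : R) (b1 b2 : bool) : lo <= u -> u <= v -> v <= hi ->
  P (X @^-1` [set` Interval (BSide b1 u) (BSide b2 v)]) = ((v - u) / (hi - lo))%:E.
Proof.
move=> lou uv vhi; have [_ ->] := unifX; last exact: measurable_itv.
have -> : [set` Interval (BSide b1 u) (BSide b2 v)] `&` `[lo, hi] =
    [set` Interval (BSide b1 u) (BSide b2 v)].
  apply: setIidl => x /=; rewrite !itv_boundlr => /andP[xu xv]; apply/andP; split.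
    by apply: le_trans xu; rewrite bnd_simp; case: (b1).
  by apply: le_trans xv _; rewrite bnd_simp; case: (b2).
rewrite lebesgue_measure_itv /= lte_fin; case: ltgtP uv => // -> _.
by rewrite subrr mul0e mul0r.
Qed.

(** The interval may stick out of [lo, hi], which leaves an inequality. *)
Lemma uniform_itv_le (u v : R) : u <= v ->
  (P (X @^-1` `[u, v]) <= ((v - u) / (hi - lo))%:E)%E.
Proof.
move=> uv; have [_ ->] := unifX; last exact: measurable_itv.
rewrite EFinM lee_wpmul2r // ?lee_fin ?invr_ge0 ?subr_ge0 ?(ltW lohi) //.
have -> : (v - u)%:E = lebesgue_measure `[u, v].
  by rewrite lebesgue_measure_itv /= lte_fin; case: ltgtP uv => // -> _; rewrite subrr.
by apply: le_measure; rewrite ?inE //; apply: measurableI.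
Qed.

End UniformLaw.

(** * Conditioning on the mesh cell of the training angles *)

Section GridCells.
Context d (Omega : measurableType d) (R : realType) (P : probability Omega R).
Variables (m n M : nat) (X Y : 'I_m -> Omega -> R) (Z : 'I_n -> Omega -> R).
Hypothesis unifX : forall i, uniform_law P (X i) 0 (pi / 2).
Hypothesis unifY : forall i, uniform_law P (Y i) (- (pi / 2)) 0.
Hypothesis unifZ : forall j, uniform_law P (Z j) (- (pi / 2)) (pi / 2).
Hypothesis indep : mutually_independent P (join3 X Y Z).
Hypothesis M0 : (0 < M)%N.
Local Open Scope classical_set_scope.

Definition mesh : R := pi / 2 / M%:R.

Definition cells := ({ffun 'I_m -> 'I_M} * {ffun 'I_m -> 'I_M})%type.

(** [s] records the mesh intervals of the X and of the reflected Y. They are open towards 0 and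
    closed away from it, so the cells partition the ranges ]0, pi/2] and [- pi/2, 0[; the candidates
    stay free. *)
Definition cell (s : cells) : set Omega :=
  cyl X Y Z (fun i => `](s.1 i)%:R * mesh, (s.1 i).+1%:R * mesh])
    (fun i => `[- ((s.2 i).+1%:R * mesh), - ((s.2 i)%:R * mesh)[) (fun=> setT).

(** The uniform laws allow the angle 0 and values out of range on null events; the geometry applies
    off these. *)
Definition typical : set Omega :=
  cyl X Y Z (fun=> `]0, pi / 2]) (fun=> `[- (pi / 2), 0[) (fun=> `[- (pi / 2), pi / 2]).

Let mX i : measurable_fun setT (X i). Proof. by case: (unifX i). Qed.
Let mY i : measurable_fun setT (Y i). Proof. by case: (unifY i). Qed.
Let mZ i : measurable_fun setT (Z i). Proof. by case: (unifZ i). Qed.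
Let pi20 : 0 < pi / 2 :> R. Proof. by rewrite divr_gt0 // pi_gt0. Qed.
Let piN20 : - (pi / 2) < 0 :> R. Proof. by rewrite oppr_lt0. Qed.
Let piN2 : - (pi / 2) < pi / 2 :> R. Proof. exact: lt_trans piN20 pi20. Qed.

Lemma mesh_gt0 : 0 < mesh.
Proof. by rewrite /mesh divr_gt0 // ltr0n. Qed.

Lemma mesh_mulM : M%:R * mesh = pi / 2.
Proof. by rewrite /mesh mulrC divfK // pnatr_eq0 -lt0n. Qed.

Lemma mesh_le (k : nat) : (k <= M)%N -> k%:R * mesh <= pi / 2.
Proof. by move=> kM; rewrite -mesh_mulM ler_pM2r ?mesh_gt0 // ler_nat. Qed.

Lemma measurable_cell s : measurable (cell s).
Proof. by apply: measurable_cyl => // i; exact: measurable_itv. Qed.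

Lemma prob_cell s : prob P (cell s) = M%:R^-1 ^+ (m + m).
Proof.
rewrite prob_cyl //; try by move=> i; exact: measurable_itv.
have h0 := ltW mesh_gt0.
have invM : mesh / (pi / 2) = M%:R^-1.
  by rewrite /mesh mulrAC divff ?mul1r // gt_eqF.
rewrite [X in _ * X]big1 ?mulr1; last first.
  by move=> j _; rewrite preimage_setT /prob probability_setT.
have hM (k : 'I_M) : k.+1%:R * mesh <= pi / 2 by apply: mesh_le.
have hS (k : nat) : k%:R * mesh <= k.+1%:R * mesh.
  by rewrite ler_wpM2r // ler_nat.
have dS (k : nat) : k.+1%:R * mesh - k%:R * mesh = mesh.
  by rewrite -mulrBl -natrB // subSnn mul1r.
rewrite exprD; congr (_ * _).
  rewrite -[m in RHS]card_ord -prodr_const; apply: eq_bigr => i _.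
  rewrite /prob (uniform_itv (unifX i)) ?dS ?subr0 ?invM //.
  by rewrite mulr_ge0.
rewrite -[m in RHS]card_ord -prodr_const; apply: eq_bigr => i _.
rewrite /prob (uniform_itv (unifY i)) ?lerN2 //.
  by rewrite opprK addrC dS opprK add0r invM.
by rewrite oppr_le0 mulr_ge0.
Qed.

Lemma measurable_typical : measurable typical.
Proof. by apply: measurable_cyl => // i; exact: measurable_itv. Qed.

Lemma prob_atypical : P (~` typical) = 0%E.
Proof.
rewrite probability_setC; last exact: measurable_typical.
rewrite -probK; last exact: measurable_typical.
rewrite prob_cyl //; try by move=> i; exact: measurable_itv.
rewrite !big1 ?mulr1 ?subee //.
- by move=> i _; rewrite /prob (uniform_itv (unifZ i)) ?(ltW piN2) //= divff // subr_eq0 gt_eqF.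
- by move=> i _; rewrite /prob (uniform_itv (unifY i)) ?(ltW piN20) //= divff // subr_eq0 gt_eqF.
- by move=> i _; rewrite /prob (uniform_itv (unifX i)) ?(ltW pi20) //= divff // subr_eq0 gt_eqF.
Qed.

Lemma mesh_cover x : 0 < x -> x <= pi / 2 ->
  exists k : 'I_M, (k%:R * mesh < x <= k.+1%:R * mesh)%R.
Proof.
move=> x0 xpi.
have ex : exists k : nat, x <= k.+1%:R * mesh.
  by exists M.-1; rewrite prednK // mesh_mulM.
case: (ex_minnP ex) => k xk kmin.
have kM : (k < M)%N.
  by rewrite -(prednK M0) ltnS; apply: kmin; rewrite prednK // mesh_mulM.
exists (Ordinal kM) => /=; rewrite xk andbT ltNge; apply/negP.
case: k xk kmin {kM} => [|k] xk kmin; first by rewrite mul0r leNgt x0.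
by move=> /kmin; rewrite ltnn.
Qed.

Lemma cell_cover w : typical w -> exists s, cell s w.
Proof.
move=> [hX hY _].
have /fin_all_exists[s1 hs1] i : exists k : 'I_M,
    (k%:R * mesh < X i w <= k.+1%:R * mesh)%R.
  by have := hX i; rewrite /= in_itv /= => /andP[]; apply: mesh_cover.
have /fin_all_exists[s2 hs2] i : exists k : 'I_M,
    (k%:R * mesh < - Y i w <= k.+1%:R * mesh)%R.
  have := hY i; rewrite /= in_itv /= => /andP[y1 y2]; apply: mesh_cover; lra.
exists ([ffun i => s1 i], [ffun i => s2 i]); split => // i /=; rewrite ffunE in_itv /=.
  exact: hs1.
by have /andP[? ?] := hs2 i; apply/andP; split; lra.
Qed.

Lemma mesh_inj (k l : 'I_M) x : (k%:R * mesh < x <= k.+1%:R * mesh)%R ->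
  (l%:R * mesh < x <= l.+1%:R * mesh)%R -> k = l.
Proof.
move=> /andP[k1 k2] /andP[l1 l2]; apply/val_inj/eqP => /=.
have := lt_le_trans k1 l2; have := lt_le_trans l1 k2.
rewrite !(ltr_pM2r mesh_gt0) !ltr_nat !ltnS => h1 h2.
by rewrite eqn_leq h1 h2.
Qed.

Lemma cell_inj s s' w : cell s w -> cell s' w -> s = s'.
Proof.
case: s => s1 s2; case: s' => t1 t2 [h1 h2 _] [h1' h2' _].
congr pair; apply/ffunP => i.
  by apply: (@mesh_inj _ _ (X i w)); [have := h1 i|have := h1' i]; rewrite /= in_itv.
apply: (@mesh_inj _ _ (- Y i w)); [have := h2 i|have := h2' i]; rewrite /= in_itv /=;
  by move=> /andP[? ?]; apply/andP; split; lra.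
Qed.

Lemma card_cells_weight : #|{: cells}|%:R * M%:R^-1 ^+ (m + m) = 1 :> R.
Proof.
rewrite card_prod !card_ffun !card_ord -expnD natrX -exprMn divff ?expr1n //.
by rewrite pnatr_eq0 -lt0n.
Qed.

(* The conditional bound [ub] fails on the exceptional part of a good cell,
   and on the bad cells, where only the bound [K] is available. *)
Lemma integral_le_cells (f : Omega -> \bar R) (good : pred cells)
    (Bad : cells -> set Omega) (ub K del : R) :
  0 <= ub -> 0 <= K -> (forall w, 0 <= f w)%E ->
  (forall s, good s -> measurable (cell s `&` Bad s)) ->
  (forall s, good s -> prob P (cell s `&` Bad s) <= del * M%:R^-1 ^+ (m + m)) ->
  (forall s w, typical w -> cell s w -> f w <= K%:E)%E ->
  (forall s w, typical w -> cell s w -> good s -> ~ Bad s w -> f w <= ub%:E)%E ->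
  0 <= del ->
  (\int[P]_w f w <=
   (ub + K * del + K * (#|[pred s | ~~ good s]|%:R * M%:R^-1 ^+ (m + m)))%:E)%E.
Proof.
move=> ub0 K0 f0 mBad pBad fK fub del0; set wt := M%:R^-1 ^+ (m + m).
(* Two terms per cell: (s, false) charges the whole cell with [ub], or [K] if it is bad; (s, true)
   charges the exceptional part of a good cell with a further [K]. *)
pose c (u : cells * bool) := if u.2 then K else if good u.1 then ub else K.
pose E (u : cells * bool) := if u.2 then
  (if good u.1 then cell u.1 `&` Bad u.1 else set0) else cell u.1.
have c0 u : 0 <= c u by rewrite /c; do 2?case: ifP => _.
have mE u : measurable (E u).
  rewrite /E; case: ifP => _; last exact: measurable_cell.
  by case: ifP => [/mBad//|_]; exact: measurable0.
have mN := measurableC measurable_typical.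
apply: le_trans (integral_le_sum c0 mE mN prob_atypical f0 _) _.
  move=> w /contrapT tw; have [s sw] := cell_cover tw.
  have term (u : cells * bool) : E u w -> c u <= \sum_i c i * \1_(E i) w.
    move=> Eu; rewrite (bigD1 u) //= indicE mem_set // mulr1 lerDl sumr_ge0 //.
    by move=> i _; rewrite mulr_ge0.
  have [gs|bs] := boolP (good s); last first.
    apply: le_trans (fK s w tw sw) _; rewrite lee_fin.
    by have := term (s, false) sw; rewrite /c /= (negbTE bs).
  have [Bs|Bs] := pselect (Bad s w).
    apply: le_trans (fK s w tw sw) _; rewrite lee_fin.
    by have := term (s, true); rewrite /E /c /= gs; apply.
  apply: le_trans (fub s w tw sw gs Bs) _; rewrite lee_fin.
  by have := term (s, false) sw; rewrite /c /= gs.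
rewrite lee_fin.
have -> : \sum_i c i * prob P (E i) =
    \sum_(s : cells) (c (s, true) * prob P (E (s, true)) + c (s, false) * prob P (E (s, false))).
  rewrite -(pair_big predT predT (fun s b => c (s, b) * prob P (E (s, b)))) /=.
  by apply: eq_bigr => s _; rewrite big_bool.
(* The cells have total weight 1, so constants can be spread over them and compared cell by cell. *)
have -> : ub + K * del + K * (#|[pred s | ~~ good s]|%:R * wt) =
    \sum_(s : cells) ((ub + K * del) * wt + (if ~~ good s then K * wt else 0)).
  rewrite big_split /= sumr_const -big_mkcond /= sumr_const.
  rewrite -[in RHS](mulr_natl _ #|xpredT|) -[in RHS](mulr_natl (K * wt)).
  rewrite [X in _ = X + _]mulrCA card_cells_weight mulr1.
  by congr (_ + _); rewrite mulrCA.
apply: ler_sum => s _; rewrite /c /E /= prob_cell -/wt.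
have wt0 : 0 <= wt by rewrite exprn_ge0 // invr_ge0.
case: ifP => gs /=.
  rewrite addr0 mulrDl addrC lerD2l -mulrA ler_wpM2l // pBad //.
rewrite /prob measure0 mulr0 add0r lerDr mulr_ge0 // addr_ge0 // mulr_ge0 //.
Qed.

(** Discarding the exceptional part costs each cell at most the share [del] of its probability. The
    cells are disjoint, so at each point at most one term of the simple function is nonzero. *)
Lemma integral_ge_cells (f : Omega -> \bar R) (Bad : cells -> set Omega)
    (c : cells -> R) (del : R) :
  (forall s, 0 <= c s) -> (forall w, 0 <= f w)%E ->
  (forall s, measurable (cell s `&` Bad s)) ->
  (forall s, prob P (cell s `&` Bad s) <= del * M%:R^-1 ^+ (m + m)) ->
  (forall s w, typical w -> cell s w -> ~ Bad s w -> (c s)%:E <= f w)%E ->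
  (((1 - del) * (M%:R^-1 ^+ (m + m) * \sum_s c s))%:E <= \int[P]_w f w)%E.
Proof.
move=> c0 f0 mBad pBad fc; set wt := M%:R^-1 ^+ (m + m).
pose E s := (cell s `\` Bad s) `&` typical.
have mD s : measurable (cell s `\` Bad s).
  have -> : cell s `\` Bad s = cell s `\` (cell s `&` Bad s).
    by rewrite setDIr setDv set0U.
  by apply: measurableD => //; exact: measurable_cell.
have mE s : measurable (E s).
  by apply: measurableI => //; exact: measurable_typical.
have pE s : (1 - del) * wt <= prob P (E s).
  have h1 : prob P (cell s `\` Bad s) <= prob P (E s).
    have mN := measurableC measurable_typical.
    apply: le_trans (prob_setD P (mD s) measurable_typical) _.
    rewrite -/(E s) gerDl.
    have -> : prob P ((cell s `\` Bad s) `\` typical) = 0; last by [].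
    rewrite /prob (@subset_measure0 _ _ _ P _ (~` typical)) //.
      by apply: measurableD => //; exact: measurable_typical.
    exact: prob_atypical.
  have h2 : prob P (cell s) <= prob P (cell s `&` Bad s) + prob P (cell s `\` Bad s).
    have := prob_setD P (measurable_cell s) (mBad s).
    by rewrite setIA setIid setDIr setDv set0U.
  move: h2; rewrite prob_cell -/wt => h2; have := pBad s; rewrite -/wt => h3; lra.
apply: (@le_trans _ _ (\sum_s c s * prob P (E s))%:E); last first.
  apply: integral_ge_sum => // w; have [[s Es]|nE] := pselect (exists s, E s w).
    have [[sw Bs] tw] := Es.
    apply: le_trans (fc s w tw sw Bs); rewrite lee_fin (bigD1 s) //= big1 ?addr0.
      by rewrite indicE mem_set // mulr1.
    move=> i si; rewrite indicE memNset ?mulr0 // => -[[iw _] _].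
    by move: si; rewrite (cell_inj iw sw) eqxx.
  rewrite big1 //= => s _; rewrite indicE memNset ?mulr0 // => Es.
  by apply: nE; exists s.
rewrite lee_fin mulrA mulr_sumr; apply: ler_sum => s _.
by rewrite mulrC ler_wpM2l.
Qed.

End GridCells.

(** * Rounded midpoints and balls of candidates around them *)

Section Estimates.
Context d (Omega : measurableType d) (R : realType) (P : probability Omega R).
Variables (m n M B : nat) (X Y : 'I_m -> Omega -> R) (Z : 'I_n -> Omega -> R).
Variable H : tset R -> pt2 R.
Hypothesis unifX : forall i, uniform_law P (X i) 0 (pi / 2).
Hypothesis unifY : forall i, uniform_law P (Y i) (- (pi / 2)) 0.
Hypothesis unifZ : forall j, uniform_law P (Z j) (- (pi / 2)) (pi / 2).
Hypothesis indep : mutually_independent P (join3 X Y Z).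
Hypothesis svmH : is_svm_learner H.
Hypothesis M0 : (0 < M)%N.
Hypothesis m0 : (0 < m)%N.
Hypothesis n0 : (0 < n)%N.
Hypothesis B0 : (0 < B)%N.
Local Open Scope classical_set_scope.
Local Notation mesh := (mesh R M).
Local Notation cells := (cells m M).
Local Notation cell := (cell X Y Z).
Implicit Types (s : cells).

Definition center (s : cells) (u v : 'I_m) : R :=
  ((s.1 u)%:R * mesh + - ((s.2 v)%:R * mesh)) / 2.

(** Mesh index of the training angle closest to 0; the default M lies above all values. *)
Definition minf (f : {ffun 'I_m -> 'I_M}) : nat := \big[Order.min/M]_i (f i : nat).

Lemma leq_minf (f : {ffun 'I_m -> 'I_M}) k :
  (k <= minf f)%N = (k <= M)%N && [forall i, (k <= f i)%N].
Proof.
apply/idP/idP.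
  by rewrite -leEnat => /bigmin_geP[-> h]; apply/forallP => i; apply: h.
move=> /andP[kM /forallP h]; rewrite -leEnat; apply/bigmin_geP; split=> // i _; exact: h.
Qed.

Lemma minf_ex f : exists2 i, minf f = f i & forall i', (f i <= f i')%N.
Proof.
have [i _ imin] := @arg_minnP _ (Ordinal m0) xpredT (fun i => f i : nat) isT.
exists i => [|i']; last exact: imin.
apply/eqP; rewrite eqn_leq leq_minf (ltnW (ltn_ord _)) /= -leEnat bigmin_le /=.
by apply/forallP => i'; apply: imin.
Qed.

Let mX i : measurable_fun setT (X i). Proof. by case: (unifX i). Qed.
Let mY i : measurable_fun setT (Y i). Proof. by case: (unifY i). Qed.
Let mZ i : measurable_fun setT (Z i). Proof. by case: (unifZ i). Qed.
Let pi0 : 0 < pi :> R. Proof. exact: pi_gt0. Qed.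
Let h0 : 0 < mesh. Proof. exact: mesh_gt0. Qed.
Let piN2 : - (pi / 2) < pi / 2 :> R.
Proof. by have := pi0; lra. Qed.
Let wt : R := M%:R^-1 ^+ (m + m).
Let wt0 : 0 < wt. Proof. by rewrite exprn_gt0 // invr_gt0 ltr0n. Qed.

Lemma ord_mesh_itv (k : 'I_M) : 0 <= k%:R * mesh <= pi / 2.
Proof.
rewrite mulr_ge0 ?(ltW h0) //=; apply: mesh_le => //; exact/ltnW/ltn_ord.
Qed.

Lemma norm_center_le s u v : `|center s u v| <= pi / 4.
Proof.
have /andP[? ?] := ord_mesh_itv (s.1 u); have /andP[? ?] := ord_mesh_itv (s.2 v).
by rewrite /center ler_norml; apply/andP; split; lra.
Qed.

Lemma cell_close s w : cell s w ->
  (forall i, `|X i w - (s.1 i)%:R * mesh| <= mesh) /\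
  (forall i, `|Y i w - - ((s.2 i)%:R * mesh)| <= mesh).
Proof.
have dS (k : nat) : k.+1%:R * mesh = k%:R * mesh + mesh by rewrite -natr1 mulrDl mul1r.
move=> [hX hY _]; split=> i; [have := hX i|have := hY i];
  rewrite /= in_itv /= dS ler_norml => /andP[? ?];
  by apply/andP; split; have := h0; lra.
Qed.

Lemma typical_range w : typical X Y Z w ->
  [/\ (forall i, 0 < X i w), (forall i, X i w <= pi / 2), (forall i, - (pi / 2) <= Y i w),
    (forall i, Y i w < 0) & forall j, `|Z j w| <= pi / 2].
Proof.
move=> [hX hY hZ]; split=> i; try by [have := hX i; rewrite /= in_itv => /andP[]
 |have := hY i; rewrite /= in_itv => /andP[]].
by have := hZ i; rewrite /= in_itv ler_norml.
Qed.

(** The two bounds by pi/4 keep the ball inside the half-circle, so its probability is exact. *)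
Lemma prob_ball (c r : R) j : `|c| <= pi / 4 -> 0 <= r -> r < pi / 4 ->
  P (Z j @^-1` `[c - r, c + r]) = (2 * r / pi)%:E.
Proof.
rewrite ler_norml => /andP[? ?] r0 rpi; rewrite (uniform_itv (unifZ j)); [|lra..].
have -> : pi / 2 - - (pi / 2) = pi :> R by lra.
by congr (_ / _)%:E; ring.
Qed.

Lemma in_ball (c r x : R) : x \in `[c - r, c + r]%classic = (`|x - c| <= r).
Proof. by rewrite mem_setE in_itv /= ler_distl. Qed.


(** * Lower bound for margin sampling, through the rounded boundary angle [phihat] *)

Definition phihat (s : cells) : R := mesh * ((minf s.1)%:R - (minf s.2)%:R) / 2.

(** The bound of [margin_Theta_ge] with e = [mesh], cut at 0 because [integral_ge_cells] takes
    nonnegative bounds. *)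
Definition margin_low r (s : cells) : R :=
  Num.max 0 ((3 / 4) * phihat s ^+ 2 - 3 * (r + mesh * 2) ^+ 2).

Lemma phihat_center s : exists u v, [/\ phihat s = center s u v,
  forall i, ((s.1 u)%:R * mesh <= (s.1 i)%:R * mesh)%R &
  forall i, (- ((s.2 i)%:R * mesh) <= - ((s.2 v)%:R * mesh))%R].
Proof.
have [u eu hu] := minf_ex s.1; have [v ev hv] := minf_ex s.2.
exists u, v; split=> [|i|i].
- by rewrite /phihat /center eu ev; congr (_ / _); ring.
- by rewrite ler_pM2r // ler_nat.
- by rewrite lerN2 ler_pM2r // ler_nat.
Qed.

Lemma Theta_star_ge0 (theta : 'I_n -> R) S : (0 <= Theta_star theta S)%E.
Proof. by apply: Theta_star_ge => j _; apply: sqr_ge0. Qed.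

(** The exceptional event is that fewer than B candidates lie within r of [phihat]. The count bound
    with t = 1/2 and p = 2r/pi has base 1 - r/pi, and division by t^B gives the factor 2^B. *)
Lemma margin_integral_ge (r del : R) : 0 <= r -> r + mesh < pi / 4 ->
  (1 - r / pi) ^+ n * 2 ^+ B <= del ->
  (((1 - del) * (wt * \sum_(s : cells) margin_low r s))%:E <=
   \int[P]_w Theta_star (fun j => Z j w)
      (margin_batch H B (fun i => X i w) (fun i => Y i w) (fun j => Z j w)))%E.
Proof.
move=> r0 rpi hdel.
pose A s : set R := `[phihat s - r, phihat s + r].
pose Bad s : set Omega := [set w | (#|[set j | Z j w \in A s]%SET| < B)%N].
have tail s : measurable (cell s `&` Bad s) /\ prob P (cell s `&` Bad s) <= del * wt.
  have [u [v [cE _ _]]] := phihat_center s.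
  have pA j : P (Z j @^-1` A s) = (2 * r / pi)%:E.
    apply: prob_ball => //; last by have := h0; lra.
    by rewrite cE norm_center_le.
  have halfQ k : (k < B)%N -> (2^-1 : R) ^+ B <= 2^-1 ^+ k.
    by move=> kB; apply: ler_wiXn2l; [lra|lra|exact: ltnW].
  have mA : measurable (A s) by exact: measurable_itv.
  have [mBad pBad] : measurable (cell s `&` Bad s) /\
      prob P (cell s `&` Bad s) * 2^-1 ^+ B <=
      prob P (cell s) * (1 - 2 * r / pi + 2^-1 * (2 * r / pi)) ^+ n.
    apply: (prob_count_le mX mY mZ indep _ _ mA pA _ halfQ); last by lra.
      by move=> i; exact: measurable_itv.
    by move=> i; exact: measurable_itv.
  split; first exact: mBad.
  rewrite (prob_cell unifX unifY) // -/wt in pBad.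
  have e1 : 1 - 2 * r / pi + 2^-1 * (2 * r / pi) = 1 - r / pi by lra.
  rewrite e1 exprVn ler_pdivrMr ?exprn_gt0 // in pBad.
  apply: le_trans pBad _; rewrite -mulrA mulrC ler_pM2r //.
apply: (integral_ge_cells unifX unifY unifZ indep M0 (Bad := Bad)) => //.
- by move=> s; rewrite /margin_low le_max lexx.
- by move=> w; apply: Theta_star_ge0.
- by move=> s; have [] := tail s.
- by move=> s; have [] := tail s.
move=> s w tw sw /negP; rewrite -leqNgt => BA.
have [a0 api bpi b0 zpi] := typical_range tw.
have [u [v [cE hu hv]]] := phihat_center s.
have [cX cY] := cell_close sw.
rewrite /margin_low EFin_max ge_max Theta_star_ge0 /= cE.
apply: (margin_Theta_ge svmH a0 api bpi b0 zpi cX cY hu hv r0 rpi).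
apply: leq_trans BA _; apply: subset_leq_card; apply/fintype.subsetP => j.
by rewrite !finset.in_set /A in_ball cE.
Qed.


(** * Upper bound for min-margin sampling, with bins of q mesh intervals *)

Definition matched (q : nat) (s : cells) : bool :=
  [exists u, exists v, (s.1 u %/ q == s.2 v %/ q)%N].

(** Indices in a common bin differ by less than q, and the center is half their difference in mesh
    units. *)
Lemma matched_center q s u v : (0 < q)%N -> (s.1 u %/ q = s.2 v %/ q)%N ->
  `|center s u v| <= q%:R * mesh / 2.
Proof.
move=> q0 e.
have h1 : (s.1 u < s.2 v + q)%N.
  rewrite [X in (X < _)%N](divn_eq _ q) e; have := ltn_pmod (s.1 u) q0.
  have := leq_trunc_div (s.2 v) q; lia.
have h2 : (s.2 v < s.1 u + q)%N.
  rewrite [X in (X < _)%N](divn_eq _ q) -e; have := ltn_pmod (s.2 v) q0.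
  have := leq_trunc_div (s.1 u) q; lia.
have {}h1 : (s.1 u)%:R * mesh <= (s.2 v)%:R * mesh + q%:R * mesh.
  by rewrite -mulrDl ler_pM2r // -natrD ler_nat ltnW.
have {}h2 : (s.2 v)%:R * mesh <= (s.1 u)%:R * mesh + q%:R * mesh.
  by rewrite -mulrDl ler_pM2r // -natrD ler_nat ltnW.
by rewrite /center ler_norml; apply/andP; split; lra.
Qed.

(** Union bound over the m^2 midpoints. *)
Lemma prob_balls_le (r : R) s j : 0 <= r ->
  measurable [set x | exists u v, `|x - center s u v| <= r] /\
  prob P (Z j @^-1` [set x | exists u v, `|x - center s u v| <= r]) <=
    m%:R ^+ 2 * (2 * r / pi).
Proof.
move=> r0; set U := [set x | _].
pose I (p : 'I_m * 'I_m) : set R := `[center s p.1 p.2 - r, center s p.1 p.2 + r].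
have mI p : measurable (I p) by exact: measurable_itv.
have UE : U = \bigcup_(p in setT) I p.
  apply/seteqP; split=> x.
    by move=> [u [v xr]]; exists (u, v) => //; apply/set_mem; rewrite in_ball.
  by move=> [[u v] _ /mem_set]; rewrite in_ball => xr; exists u, v.
have mU : measurable U by rewrite UE; apply: fin_bigcup_measurable.
split => //.
have [_ hP] := @prob_exists_le _ _ _ P _ predT (fun p => Z j @^-1` I p)
  (fun p _ => measurable_preim (mZ j) (mI p)).
have -> : Z j @^-1` U = [set w | exists2 p, predT p & (Z j @^-1` I p) w].
  rewrite UE; apply/seteqP; split=> w /=.
    by move=> [p _ pw]; exists p.
  by move=> [p _ pw]; exists p.
apply: le_trans hP _.
have -> : m%:R ^+ 2 * (2 * r / pi) = \sum_(p : 'I_m * 'I_m) (2 * r / pi) :> R.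
  by rewrite sumr_const (card_prod 'I_m 'I_m) card_ord expr2 -natrM mulr_natl.
apply: ler_sum => p _; rewrite -lee_fin probK; last first.
  exact: (measurable_preim (mZ j) (mI p)).
apply: le_trans (uniform_itv_le piN2 (unifZ j) _) _; first lra.
rewrite lee_fin.
have -> : pi / 2 - - (pi / 2) = pi :> R by lra.
by rewrite ler_pM2r ?invr_gt0 //; lra.
Qed.

(** Two events are exceptional: more than B candidates near the midpoints ([Bad2], t = 6/5), and
    none near a chosen matched midpoint ([Bad3], t = 0). Off these, the candidate near the matched
    midpoint is in the batch. *)
Lemma minmargin_integral_le (q k : nat) (r d2 d3 : R) : (0 < q)%N -> (0 < k)%N ->
  0 <= r -> r + mesh < pi / 4 ->
  (1 + 5^-1 * (m%:R ^+ 2 * (2 * (r + mesh * 2) / pi))) ^+ n <= d2 * (6 / 5) ^+ B ->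
  (1 - 2 * r / pi) ^+ n <= d3 ->
  (\int[P]_w Theta_star (fun j => Z j w)
      (minmargin_batch H k B (fun i => X i w) (fun i => Y i w) (fun j => Z j w)) <=
   ((q%:R * mesh / 2 + r) ^+ 2 + (pi / 2) ^+ 2 * (d2 + d3) +
     (pi / 2) ^+ 2 * (#|[pred s | ~~ matched q s]|%:R * wt))%:E)%E.
Proof.
move=> q0 k0 r0 rpi hd2 hd3.
have o0 := Ordinal m0.
(* A matched pair if there is one; the default serves only on unmatched cells. *)
pose uv s := odflt (o0, o0) [pick p | (s.1 p.1 %/ q == s.2 p.2 %/ q)%N].
have uvP s : matched q s -> (s.1 (uv s).1 %/ q = s.2 (uv s).2 %/ q)%N.
  move=> /existsP[u /existsP[v e]]; rewrite /uv; case: pickP => [p /eqP //|/(_ (u, v))].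
  by rewrite /= e.
pose c s := center s (uv s).1 (uv s).2.
pose W s : set R := `[c s - r, c s + r].
pose U s : set R := [set x | exists u v, `|x - center s u v| <= r + mesh * 2].
pose Bad2 s : set Omega := [set w | (B < #|[set j | Z j w \in U s]%SET|)%N].
pose Bad3 s : set Omega := [set w | (#|[set j | Z j w \in W s]%SET| == 0)%N].
have r20 : 0 <= r + mesh * 2 by have := h0; lra.
have mIX s i : measurable `](s.1 i)%:R * mesh, (s.1 i).+1%:R * mesh] by exact: measurable_itv.
have mIY s i : measurable `[- ((s.2 i).+1%:R * mesh), - ((s.2 i)%:R * mesh)[.
  exact: measurable_itv.
have tail2 s : measurable (cell s `&` Bad2 s) /\ prob P (cell s `&` Bad2 s) <= d2 * wt.
  have j0 := Ordinal n0.
  have mU : measurable (U s) by case: (prob_balls_le s j0 r20).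
  set p := prob P (Z j0 @^-1` U s).
  (* [prob_count_le] takes one exact probability common to all candidates; the union bound on p
     enters only in the final comparison. *)
  have pU j : P (Z j @^-1` U s) = p%:E.
    rewrite /p probK; last exact: measurable_preim.
    by case: (unifZ j) => _ ->//; case: (unifZ j0) => _ ->.
  have geQ l : (B < l)%N -> (6 / 5 : R) ^+ B <= (6 / 5) ^+ l.
    by move=> Bl; rewrite ler_eXn2l ?(ltnW Bl) //; lra.
  have [mBad pBad] : measurable (cell s `&` Bad2 s) /\
      prob P (cell s `&` Bad2 s) * (6 / 5) ^+ B <=
      prob P (cell s) * (1 - p + (6 / 5) * p) ^+ n.
    by apply: (prob_count_le mX mY mZ indep _ _ mU pU _ geQ).
  split; first exact: mBad.
  rewrite (prob_cell unifX unifY) // -/wt in pBad.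
  rewrite -(ler_pM2r (_ : 0 < (6 / 5) ^+ B)); last by rewrite exprn_gt0 //; lra.
  apply: le_trans pBad _; rewrite [leRHS]mulrAC [leRHS]mulrC ler_pM2l //.
  apply: le_trans hd2; apply: lerXn2r; rewrite ?nnegrE.
  - by have p0 : 0 <= p := prob_ge0 _ _; lra.
  - rewrite addr_ge0 // mulr_ge0 ?invr_ge0 // mulr_ge0 ?exprn_ge0 // divr_ge0 ?(ltW pi0) //.
    by rewrite mulr_ge0.
  - by have [_] := prob_balls_le s j0 r20; rewrite -/(U s) -/p; lra.
have tail3 s : measurable (cell s `&` Bad3 s) /\ prob P (cell s `&` Bad3 s) <= d3 * wt.
  have pW j : P (Z j @^-1` W s) = (2 * r / pi)%:E.
    by apply: prob_ball => //; [exact: norm_center_le|have := h0; lra].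
  have mW : measurable (W s) by exact: measurable_itv.
  (* As 0^0 = 1 and higher powers vanish, t = 0 singles out the count 0. *)
  have Q0 l : (l == 0)%N -> (1 : R) <= 0 ^+ l by move=> /eqP ->; rewrite expr0.
  have [mBad pBad] : measurable (cell s `&` Bad3 s) /\
      prob P (cell s `&` Bad3 s) * 1 <=
      prob P (cell s) * (1 - 2 * r / pi + 0 * (2 * r / pi)) ^+ n.
    by apply: (prob_count_le mX mY mZ indep _ _ mW pW _ Q0).
  split; first exact: mBad.
  rewrite mulr1 (prob_cell unifX unifY) // -/wt mul0r addr0 in pBad.
  by apply: le_trans pBad _; rewrite mulrC ler_pM2r.
(* Some cell exists, and its exceptional probability is nonnegative, which forces the sign of [d2],
   and likewise of [d3]. *)
have d20 : 0 <= d2.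
  have [_] := tail2 ([ffun => Ordinal M0], [ffun => Ordinal M0]).
  by move/(le_trans (prob_ge0 _ _)); rewrite pmulr_lge0.
have d30 : 0 <= d3.
  have [_] := tail3 ([ffun => Ordinal M0], [ffun => Ordinal M0]).
  by move/(le_trans (prob_ge0 _ _)); rewrite pmulr_lge0.
apply: (integral_le_cells unifX unifY unifZ indep M0
  (Bad := fun s => Bad2 s `|` Bad3 s)) => //.
- exact: sqr_ge0.
- exact: sqr_ge0.
- by move=> w; apply: Theta_star_ge0.
- move=> s _; rewrite setIUr.
  by apply: measurableU; [case: (tail2 s)|case: (tail3 s)].
- move=> s _; rewrite setIUr mulrDl.
  have [m2 p2] := tail2 s; have [m3 p3] := tail3 s.
  apply: le_trans (lerD p2 p3).
  rewrite -lee_fin EFinD !probK //; last exact: measurableU.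
  exact: measureU2.
- move=> s w tw sw; have [a0 api bpi b0 zpi] := typical_range tw.
  exact: Theta_minmargin_le.
- move=> s w tw sw gs /not_orP[/negP nB2 nB3].
  have [a0 api bpi b0 zpi] := typical_range tw.
  have [cX cY] := cell_close sw.
  have [j jW] : exists j, Z j w \in W s.
    apply: contrapT => nex; apply: nB3; rewrite /Bad3 /= cards_eq0.
    by apply/eqP/setP => j; rewrite !finset.in_set; apply/negP => jW; apply: nex; exists j.
  apply: (minmargin_Theta_le svmH a0 api bpi b0 zpi cX cY k0 rpi (j := j)).
  + by move: jW; rewrite /W in_ball; apply.
  + exact: (matched_center q0 (uvP s gs)).
  + rewrite -leqNgt in nB2; apply: leq_trans nB2; apply: subset_leq_card.
    apply/fintype.subsetP => l; rewrite !finset.in_set => /existsP[u /existsP[v luv]].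
    by apply/mem_set; exists u, v.
- by rewrite addr_ge0.
Qed.

End Estimates.

(** * Counting unmatched cells *)

Section Counting.
Variables (m M : nat).
Hypothesis m0 : (0 < m)%N.

(* If no X and no Y share a bin, the set A of bins hit by the X separates them;
   A and its complement hold x + y = M mesh intervals, and 4xy <= (x + y)^2. *)
Lemma card_unmatched_le (q L : nat) : M = (q * L)%N -> (0 < q)%N ->
  (#|[pred s : cells m M | ~~ matched q s]| * 4 ^ m <= 2 ^ L * M ^ (m + m))%N.
Proof.
move=> ML q0.
have binP (k : 'I_M) : (k %/ q < L)%N by rewrite ltn_divLR // mulnC -ML.
pose bin (k : 'I_M) := Ordinal (binP k).
pose D (A : {set 'I_L}) : pred 'I_M := [pred k | bin k \in A].
pose F A (s : cells m M) := (s.1 \in ffun_on (D A)) && (s.2 \in ffun_on (predC (D A))).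
have le1 : (#|[pred s : cells m M | ~~ matched q s]| <= \sum_(A : {set 'I_L}) #|F A|)%N.
  under [leqRHS]eq_bigr do rewrite -sum1_card big_mkcond /=.
  rewrite exchange_big /= -sum1_card big_mkcond /=; apply: leq_sum => s _.
  case: ifP => // ns; pose A := [set bin (s.1 i) | i : 'I_m]%SET.
  rewrite (bigD1 A) //= (_ : (s \in F A) = true) //.
  apply/andP; split; apply/ffun_onP => i; rewrite inE /=; first exact: imset_f.
  apply/negP => /imsetP[u _ e]; move: ns => /negP; apply.
  apply/existsP; exists u; apply/existsP; exists i.
  by have := congr1 val e => /= ->.
apply: (@leq_trans (\sum_(A : {set 'I_L}) #|F A| * 4 ^ m)%N).
  by rewrite -big_distrl leq_mul2r le1 orbT.
apply: (@leq_trans (\sum_(A : {set 'I_L}) M ^ (m + m))%N); last first.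
  by rewrite sum_nat_const -cardsT -powersetT card_powerset cardsT card_ord.
apply: leq_sum => A _.
have -> : #|F A| = (#|D A| ^ m * #|predC (D A)| ^ m)%N.
  rewrite -[m in (_ ^ m * _)%N]card_ord -[m in (_ * _ ^ m)%N]card_ord -!card_ffun_on.
  by rewrite -cardX; apply: eq_card => s; rewrite inE.
have := cardC (D A); rewrite card_ord; move: #|D A| #|predC (D A)| => x y <-.
rewrite -!expnMn addnn -mul2n expnM leq_exp2r //.
rewrite mulnC -[4%N]/(2 ^ 2)%N nat_AGM2 //.
Qed.

Lemma card_minf_ge k : (k <= M)%N ->
  #|[pred f : {ffun 'I_m -> 'I_M} | (k <= minf f)%N]| = ((M - k) ^ m)%N.
Proof.
move=> kM; pose D : pred 'I_M := [pred x : 'I_M | (k <= x)%N].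
rewrite -[m in RHS]card_ord.
have <- : #|D| = (M - k)%N.
  rewrite -sum1_card -(big_mkord (fun x => k <= x)%N (fun=> 1%N)).
  rewrite (big_cat_nat (leq0n k) kM) //= big_nat_cond big_pred0 ?add0n.
    rewrite big_nat_cond (eq_bigl (fun i => (k <= i < M)%N)).
      by rewrite -big_nat sum_nat_const_nat muln1.
    by move=> i; rewrite andbC; case: (k <= i)%N.
  by move=> i; rewrite -andbA ltnNge; case: (k <= i)%N; rewrite ?andbF.
rewrite -card_ffun_on; apply: eq_card => f; rewrite inE leq_minf kM /=.
by apply/forallP/ffun_onP.
Qed.

(** * Second moment of the difference of two independent minima *)

Variable R : realType.
Local Notation S a := (\sum_(j < M) (j%:R : R) ^+ a).

(** Summation by parts: G (minf f) is the sum of the increments of G at all k < minf f, and (M - k -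
    1)^m functions have minimum above k. The substitution j = M - k - 1 gives the right side. *)
Lemma sum_minf (G : nat -> R) : G 0%N = 0 ->
  \sum_(f : {ffun 'I_m -> 'I_M}) G (minf f) =
  \sum_(j < M) (G (M - j)%N - G (M - j).-1) * j%:R ^+ m.
Proof.
move=> G0.
have GE x : (x <= M)%N -> G x = \sum_(k < M) (if (k < x)%N then G k.+1 - G k else 0).
  move=> xM; rewrite -(big_mkord xpredT (fun k => if (k < x)%N then G k.+1 - G k else 0)).
  rewrite (big_cat_nat (leq0n x) xM) /= [X in _ + X]big_nat [X in _ + X]big1 ?addr0; last first.
    by move=> i /andP[xi _]; rewrite ltnNge xi.
  rewrite big_nat (eq_bigr (fun k => G k.+1 - G k)); last by move=> i /andP[_ ->].
  by rewrite -big_nat telescope_sumr // G0 subr0.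
transitivity (\sum_(f : {ffun 'I_m -> 'I_M}) \sum_(k < M)
    (if (k < minf f)%N then G k.+1 - G k else 0)).
  by apply: eq_bigr => f _; rewrite -GE // -leEnat bigmin_le_id.
rewrite exchange_big /= [RHS](reindex_inj rev_ord_inj) /=.
apply: eq_bigr => k _; rewrite -big_mkcond sumr_const.
rewrite (card_minf_ge (ltn_ord k)) -[LHS]mulr_natr natrX.
congr (_ * _); have := ltn_ord k => kM.
by rewrite subKn.
Qed.

(** With [exprS_le], this encloses the increment of x^(a+1) between (a+1) x^a and (a+1) (x+1)^a;
    summing the increments yields the power sum estimates. *)
Lemma exprS_ge (x : R) a : 0 <= x -> x ^+ a.+1 + a.+1%:R * x ^+ a <= (x + 1) ^+ a.+1.
Proof.
move=> x0; elim: a => [|a IH]; first by rewrite !expr1 expr0 mulr1.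
rewrite [leRHS]exprS; apply: (@le_trans _ _ ((x + 1) * (x ^+ a.+1 + a.+1%:R * x ^+ a))).
  have : 0 <= a.+1%:R * x ^+ a by rewrite mulr_ge0 // exprn_ge0.
  rewrite -[a.+2%:R]natr1 !exprS; set y := x ^+ a; nra.
by rewrite ler_wpM2l // addr_ge0.
Qed.

Lemma exprS_le (x : R) a : 0 <= x -> (x + 1) ^+ a.+1 <= x ^+ a.+1 + a.+1%:R * (x + 1) ^+ a.
Proof.
move=> x0; elim: a => [|a IH]; first by rewrite !expr1 expr0 mulr1.
rewrite [leLHS]exprS.
apply: (@le_trans _ _ ((x + 1) * (x ^+ a.+1 + a.+1%:R * (x + 1) ^+ a))).
  by rewrite ler_wpM2l // addr_ge0.
have : x ^+ a.+1 <= (x + 1) ^+ a.+1 by apply: lerXn2r; rewrite ?nnegrE ?addr_ge0 ?lerDl.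
by rewrite -[a.+2%:R]natr1 [(x + 1) ^+ a.+1]exprS [x ^+ a.+2]exprS => h; lra.
Qed.

Lemma power_sum_le a : a.+1%:R * S a <= M%:R ^+ a.+1.
Proof.
elim: M => [|N IH]; first by rewrite big_ord0 mulr0 expr0n.
rewrite big_ord_recr /= mulrDr -[N.+1%:R]natr1; apply: le_trans (exprS_ge _ _) => //.
by rewrite lerD2r.
Qed.

Lemma power_sum_ge a : (0 < a)%N -> M%:R ^+ a.+1 <= a.+1%:R * (S a + M%:R ^+ a).
Proof.
move=> a0; elim: M => [|N IH].
  by rewrite big_ord0 expr0n /= expr0n eqn0Ngt a0 /= addr0 mulr0.
rewrite big_ord_recr /= mulrDr -[N.+1%:R]natr1; apply: le_trans (exprS_le _ _) _ => //.
by rewrite lerD2r.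
Qed.

(** For independent copies U, V the mean of (U - V)^2 is 2 E[U^2] - 2 E[U]^2. [sum_minf] expresses
    both moments by power sums; the left side is about 2 (M/m)^2. *)
Lemma sum_minf_diff_sq : (0 < M)%N ->
  2 * ((2 * M%:R - 1) * (M%:R / m.+1%:R - 1) - 2 * (M%:R ^+ 2 / m.+2%:R))
    - 2 * (M%:R / m.+1%:R) ^+ 2 <=
  M%:R^-1 ^+ (m + m) *
    \sum_(s : cells m M) ((minf s.1)%:R - (minf s.2)%:R : R) ^+ 2.
Proof.
move=> M0.
have Mp : 0 < M%:R :> R by rewrite ltr0n.
set T : R := M%:R ^+ m; have T0 : 0 < T by rewrite exprn_gt0.
pose S1 : R := \sum_(f : {ffun 'I_m -> 'I_M}) (minf f)%:R.
pose S2 : R := \sum_(f : {ffun 'I_m -> 'I_M}) (minf f)%:R ^+ 2.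
have S1E : S1 = S m.
  rewrite /S1 (sum_minf (G := fun x => x%:R)) //; apply: eq_bigr => j _.
  rewrite -[X in X%:R - _]prednK ?subn_gt0 // -natr1.
  by rewrite addrAC subrr add0r mul1r.
have S2E : S2 = (2 * M%:R - 1) * S m - 2 * S m.+1.
  (* The increment of the square is (M - j)^2 - (M - j - 1)^2 = (2M - 1) - 2j. *)
  rewrite /S2 (sum_minf (G := fun x => x%:R ^+ 2)) ?expr0n //.
  rewrite !mulr_sumr -sumrB; apply: eq_bigr => j _.
  have -> : (M - j).-1%:R = M%:R - j%:R - 1 :> R.
    by rewrite -subn1 natrB ?subn_gt0 // natrB // ltnW.
  by rewrite natrB ?(ltnW (ltn_ord j)) // [j%:R ^+ m.+1]exprS; ring.
have sumE : \sum_(s : cells m M) ((minf s.1)%:R - (minf s.2)%:R : R) ^+ 2 =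
    2 * (T * S2) - 2 * S1 ^+ 2.
  rewrite -(pair_big predT predT (fun f g : {ffun 'I_m -> 'I_M} =>
    ((minf f)%:R - (minf g)%:R : R) ^+ 2)) /=.
  have cT : #|{: {ffun 'I_m -> 'I_M}}|%:R = T by rewrite card_ffun !card_ord natrX.
  transitivity (\sum_(f : {ffun 'I_m -> 'I_M}) (T * (minf f)%:R ^+ 2 + S2 - 2 * (minf f)%:R * S1)).
    apply: eq_bigr => f _.
    have -> : T * (minf f)%:R ^+ 2 = \sum_(g : {ffun 'I_m -> 'I_M}) (minf f)%:R ^+ 2.
      by rewrite sumr_const -cT mulr_natl.
    rewrite /S1 mulr_sumr /S2.
    rewrite -big_split -sumrB /=; apply: eq_bigr => g _; ring.
  rewrite sumrB big_split /= -mulr_sumr -/S2.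
  have -> : \sum_(f : {ffun 'I_m -> 'I_M}) S2 = T * S2.
    by rewrite sumr_const -cT mulr_natl.
  rewrite -mulr_suml -mulr_sumr -/S1; ring.
rewrite sumE S2E S1E.
have le1 : S m <= T * (M%:R / m.+1%:R).
  rewrite mulrA ler_pdivlMr // mulrC; apply: le_trans (power_sum_le m) _.
  by rewrite exprSr lexx.
have ge1 : T * (M%:R / m.+1%:R - 1) <= S m.
  rewrite mulrBr mulr1 lerBlDr mulrA ler_pdivrMr //.
  by have := power_sum_ge m0; rewrite exprSr -/T; lra.
have le2 : S m.+1 <= T * (M%:R ^+ 2 / m.+2%:R).
  rewrite mulrA ler_pdivlMr // mulrC; apply: le_trans (power_sum_le m.+1) _.
  by rewrite /T -exprD addn2 lexx.
have Sm0 : 0 <= S m by apply: sumr_ge0 => j _; apply: exprn_ge0.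
have M1 : 1 <= M%:R :> R by rewrite ler1n.
rewrite exprVn exprD -/T ler_pdivlMl ?mulr_gt0 //.
have h3 : S m ^+ 2 <= (T * (M%:R / m.+1%:R)) ^+ 2.
  by apply: lerXn2r; rewrite ?nnegrE // (le_trans Sm0 le1).
have h4 : (2 * M%:R - 1) * (T * (M%:R / m.+1%:R - 1)) <= (2 * M%:R - 1) * S m.
  by apply: ler_wpM2l => //; lra.
have h5 : T * ((2 * M%:R - 1) * (T * (M%:R / m.+1%:R - 1)) - 2 * (T * (M%:R ^+ 2 / m.+2%:R)))
   <= T * ((2 * M%:R - 1) * S m - 2 * S m.+1).
  by rewrite ler_pM2l // lerB // ler_pM2l.
clear -h3 h5; move: h3 h5; set mu := M%:R / m.+1%:R; set nu := M%:R ^+ 2 / m.+2%:R.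
move: (S m) (S m.+1) mu nu => s1 s2 mu nu; rewrite exprMn => h3 h5; lra.
Qed.

End Counting.

(** * Elementary exponential inequalities *)

Section Numerics.
Variable R : realType.
Implicit Types (x y b mu : R).

Lemma exprn_le_expR x n : 0 <= 1 + x -> (1 + x) ^+ n <= expR (n%:R * x).
Proof.
move=> x0; rewrite expRM_natl; apply: lerXn2r; rewrite ?nnegrE ?expR_ge0 //.
exact: expR_ge1Dx.
Qed.

(** Halving the exponent makes e^(-x) >= 1 - x sharp enough: (1 - 173/2000)^2 >= 5/6. *)
Lemma expR_173_le : expR (173 / 1000 : R) <= 6 / 5.
Proof.
have -> : 173 / 1000 = 173 / 2000 *+ 2 :> R by lra.
rewrite -mulr_natl expRM_natl -[expR _]invrK -expRN exprVn.
have : 1 + - (173 / 2000) <= expR (- (173 / 2000)) :> R := expR_ge1Dx _.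
set e := expR _ => he.
rewrite -[leRHS]invrK lef_pV2 ?posrE ?exprn_gt0 //; try lra.
by rewrite expr2; nra.
Qed.

(** From e^(1/5) >= 6/5 and (6/5)^4 > 2. *)
Lemma two_le_expR : 2 <= expR (8 / 10 : R).
Proof.
have -> : 8 / 10 = 4%:R * (2 / 10) :> R by lra.
rewrite expRM_natl; have : 1 + 2 / 10 <= expR (2 / 10) :> R := expR_ge1Dx _.
set e := expR _ => he.
have : (1 + 2 / 10) ^+ 4 <= e ^+ 4 by apply: lerXn2r; rewrite ?nnegrE; lra.
by apply: le_trans; lra.
Qed.

(** Induction from 100: a step multiplies the left side by at most (101/100)^4 < 2, and at the start
    10^12 = (10^3)^4 <= (2^10)^4. *)
Lemma two_exp_ge m : (100 <= m)%N -> 10000 * m%:R ^+ 4 <= 2 ^+ m :> R.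
Proof.
elim: m => // m IH; rewrite leq_eqVlt => /orP[/eqP <-|]; last first.
  rewrite ltnS => hm; have {}IH := IH hm.
  have mu100 : 100 <= m%:R :> R by rewrite (ler_nat R 100).
  rewrite -[m.+1%:R]natr1 [leRHS]exprS; apply: le_trans (ler_wpM2l _ IH) => //.
  rewrite [leRHS]mulrCA; apply: ler_wpM2l; first exact: ler0n.
  move: mu100; move: (m%:R : R) => x x100.
  have : x + 1 <= 101 / 100 * x by lra.
  move=> h; apply: (@le_trans _ _ ((101 / 100 * x) ^+ 4)).
    by apply: lerXn2r; rewrite ?nnegrE; lra.
  by rewrite exprMn ler_wpM2r ?exprn_ge0 //; lra.
rewrite (_ : 100 = (10 * 10))%N // [leRHS]exprM natrM.
have e10 : (2 : R) ^+ 10 = 4 ^+ 5 by rewrite (_ : 10 = 2 * 5)%N // exprM; congr (_ ^+ _); ring.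
have x10 : 10 ^+ 3 <= (2 : R) ^+ 10 by rewrite e10 !exprS expr0; lra.
have -> : 10000 * (10%:R * 10%:R) ^+ 4 = (10 ^+ 3) ^+ 4 :> R by ring.
apply: (@le_trans _ _ ((2 ^+ 10) ^+ 4)); first by apply: lerXn2r; rewrite ?nnegrE //; lra.
by apply: ler_weXn2l => //; lra.
Qed.

End Numerics.

(** * Comparison of the main terms and the errors *)

(* Angles are measured in units of pi / (4 mu), where mu is the class size. *)
Section Budget.
Variable R : realType.
Variables (mu b N M : R).
Hypothesis mu100 : 100 <= mu.
Hypothesis b1 : 1 <= b.
Hypothesis bN : 12 * b * mu <= N.
Hypothesis MN : 100 * N * mu ^+ 2 <= M.
Let tau : R := pi / (4 * mu).

Let pi0 : 0 < pi :> R. Proof. exact: pi_gt0. Qed.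
Let mu0 : 0 < mu. Proof. by apply: lt_le_trans mu100; rewrite ltr0n. Qed.
Let bmu : mu <= b * mu. Proof. by rewrite ler_peMl // ltW. Qed.
Let N1200 : 1200 <= N. Proof. by move: bmu bN mu100; lra. Qed.
Let N0 : 0 < N. Proof. by apply: lt_le_trans N1200; rewrite ltr0n. Qed.
Let M_mu2 : 1000 * mu ^+ 2 <= M.
Proof.
have h : 1000 <= 100 * N by have := N1200; lra.
by apply: le_trans MN; exact: (ler_wpM2r (sqr_ge0 mu) h).
Qed.
Let M_mu : 1000 * 100 * mu <= M.
Proof.
have h : 1000 * 100 <= 1000 * mu by have := mu100; lra.
by apply: le_trans M_mu2; rewrite expr2 mulrA; exact: (ler_wpM2r (ltW mu0) h).
Qed.
Let M0 : 0 < M.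
Proof. by have := M_mu; have := mu100; lra. Qed.
Let tau0 : 0 < tau. Proof. by rewrite divr_gt0 // mulr_gt0. Qed.
Let piE : pi = 4 * mu * tau. Proof. by rewrite /tau; field; rewrite gt_eqF. Qed.

(** With a = M/(mu+1) and c = M/(mu+2), the identity M (a - c) = a c turns the main terms into 2a
    (2c - a), close to 2 (M/mu)^2. The rest is at most 5M, small because M >= 1000 mu^2. *)
Lemma budget_second_moment (E : R) :
  2 * ((2 * M - 1) * (M / (mu + 1) - 1) - 2 * (M ^+ 2 / (mu + 2)))
    - 2 * (M / (mu + 1)) ^+ 2 <= E -> 189 / 100 * (M / mu) ^+ 2 <= E.
Proof.
have hmu := mu100; have hmu0 := mu0; have hM := M_mu; have hM0 := M0; have htau0 := tau0.
have hbN := bN; have hN0 := N0; have hb := b1.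
apply: le_trans.
set s := M / mu; set a := M / (mu + 1).
have eM : M = s * mu by rewrite /s divfK // gt_eqF.
have ea : a * (mu + 1) = M by rewrite /a divfK // gt_eqF // ltr_wpDr.
pose c := M / (mu + 2).
have ec : c * (mu + 2) = M by rewrite /c divfK // gt_eqF // ltr_wpDr.
have -> : M ^+ 2 / (mu + 2) = M * c by rewrite /c expr2 mulrA.
have s0 : 0 < s by rewrite divr_gt0.
have aE : M * (a - c) = a * c by rewrite mulrBr -{1}ec -{1}ea; ring.
have a_ge : 99 / 100 * s <= a.
  rewrite -(ler_pM2r (_ : 0 < mu + 1)) ?ea ?eM; last by lra.
  have : 0 <= s * (mu - 100) by rewrite mulr_ge0 ?subr_ge0 // ltW.
  by lra.
have c_ge : 98 / 100 * s <= c.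
  rewrite -(ler_pM2r (_ : 0 < mu + 2)) ?ec ?eM; last by lra.
  have : 0 <= s * (mu - 100) by rewrite mulr_ge0 ?subr_ge0 // ltW.
  by lra.
have a_le : a <= s.
  rewrite -(ler_pM2r (_ : 0 < mu + 1)) ?ea ?eM; lra.
have M_le : 5 * M <= 1 / 100 * s ^+ 2.
  have h : 1000 * mu <= s by rewrite /s ler_pdivlMr // -mulrA -expr2.
  rewrite eM; have : 0 <= s * (s - 1000 * mu) by rewrite mulr_ge0 ?subr_ge0 // ltW.
  by have : 0 <= s * mu by [rewrite mulr_ge0 // ltW]; lra.
have ac : 2 * (99 / 100 * s) * (96 / 100 * s) <= 2 * a * (2 * c - a).
  by apply: ler_pM; lra.
have sM : 100 * s <= M.
  have : 0 <= s * (mu - 100) by rewrite mulr_ge0 ?subr_ge0 // ltW.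
  by rewrite eM; lra.
lra.
Qed.

(** The radius is at most tau/3 because N >= 12 b mu, and the rounding adds at most tau/1000. In
    units of tau^2 this leaves 99/100 (3/4 * 1.89 - 3 * 0.335^2), above 1.06. *)
Lemma budget_margin (E : R) : 189 / 100 * (M / mu) ^+ 2 <= E ->
  106 / 100 * tau ^+ 2 <= 99 / 100 *
    (3 / 4 * ((pi / 2 / M) ^+ 2 / 4 * E) - 3 * (pi * b / N + pi / 2 / M * 2) ^+ 2).
Proof.
have hmu := mu100; have hmu0 := mu0; have hM := M_mu; have hM0 := M0; have htau0 := tau0.
have hbN := bN; have hN0 := N0; have hb := b1.
move=> hE.
have h1 : 189 / 100 * tau ^+ 2 <= (pi / 2 / M) ^+ 2 / 4 * E.
  apply: (@le_trans _ _ ((pi / 2 / M) ^+ 2 / 4 * (189 / 100 * (M / mu) ^+ 2))); last first.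
    by rewrite ler_wpM2l // divr_ge0 // sqr_ge0.
  rewrite (_ : (pi / 2 / M) ^+ 2 / 4 * _ = 189 / 100 * tau ^+ 2) //.
  by rewrite /tau; field; rewrite !gt_eqF.
have h2 : pi * b / N <= tau / 3.
  rewrite ler_pdivrMr // piE.
  have : 0 <= tau * (N - 12 * b * mu) by rewrite mulr_ge0 ?subr_ge0 // ltW.
  by lra.
have h3 : pi / 2 / M * 2 <= tau / 1000.
  rewrite (_ : _ * 2 = pi / M); last by field; rewrite gt_eqF.
  rewrite ler_pdivrMr // piE.
  have : 0 <= tau * (M - 1000 * 100 * mu) by rewrite mulr_ge0 ?subr_ge0 // ltW.
  have : 0 <= tau * mu by rewrite mulr_ge0 // ltW.
  by lra.
have h4 : (pi * b / N + pi / 2 / M * 2) ^+ 2 <= (tau * (335 / 1000)) ^+ 2.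
  have p1 : 0 <= pi * b / N.
    by apply: divr_ge0; [apply: mulr_ge0; [exact/ltW/pi0|lra]|exact: ltW].
  have p2 : 0 <= pi / 2 / M * 2.
    by apply: mulr_ge0; [apply: divr_ge0; [have := pi0; lra|exact: ltW]|lra].
  by apply: lerXn2r; rewrite ?nnegrE; lra.
have := sqr_ge0 tau; move: h1 h4; rewrite (exprMn 2 tau).
set A := (pi / 2 / M) ^+ 2 / 4 * E; set C := (pi * b / N + _) ^+ 2.
by move: (tau ^+ 2) => t h1 h4 h5; lra.
Qed.

(** Half a bin is pi/(4L), about 2/3 tau as L is about 3/2 mu, so the square is at most 0.67^2
    tau^2. The exceptional probabilities add 0.04 + 0.4 + 0.04. *)
Lemma budget_minmargin (q L d2 d3 e : R) : M = q * L -> 3 * mu <= 2 * L + 1 ->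
  d2 <= (100 * mu ^+ 2)^-1 -> d3 <= (10 * mu ^+ 2)^-1 -> e <= (100 * mu ^+ 2)^-1 ->
  (q * (pi / 2 / M) / 2 + 5 / 12 * (b / N) * pi / mu ^+ 2) ^+ 2
    + (pi / 2) ^+ 2 * (d2 + d3) + (pi / 2) ^+ 2 * e <= 95 / 100 * tau ^+ 2.
Proof.
have hmu := mu100; have hmu0 := mu0; have hM := M_mu; have hM0 := M0; have htau0 := tau0.
have hbN := bN; have hN0 := N0; have hb := b1.
move=> ML hL h2 h3 he.
have L0 : 0 < L by lra.
have q0 : 0 < q by move: M0; rewrite ML pmulr_lgt0.
have g1 : q * (pi / 2 / M) / 2 <= tau * (669 / 1000).
  rewrite (_ : _ / 2 = pi / (4 * L)); last first.
    by rewrite ML; field; rewrite !gt_eqF.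
  rewrite ler_pdivrMr; last by rewrite mulr_gt0.
  rewrite piE.
  have : 0 <= tau * (2 * L + 1 - 3 * mu) by rewrite mulr_ge0 ?subr_ge0 // ltW.
  have : 0 <= tau * (mu - 100) by rewrite mulr_ge0 ?subr_ge0 // ltW.
  by lra.
have g2 : 5 / 12 * (b / N) * pi / mu ^+ 2 <= tau / 1000.
  rewrite ler_pdivrMr ?exprn_gt0 // piE.
  have h : b / N * (12 * mu) <= 1.
    by rewrite mulrAC ler_pdivrMr //; lra.
  have h' : 0 <= tau * (1 - b / N * (12 * mu)) by rewrite mulr_ge0 ?subr_ge0 // ltW.
  have mu2 : 0 <= mu ^+ 2 - 10000 by have := sqr_ge0 (mu - 100); lra.
  by have := mulr_ge0 (ltW htau0) mu2; lra.
have g3 : (q * (pi / 2 / M) / 2 + 5 / 12 * (b / N) * pi / mu ^+ 2) ^+ 2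
    <= (tau * (67 / 100)) ^+ 2.
  have p1 : 0 <= q * (pi / 2 / M) / 2.
    apply: divr_ge0; last by lra.
    by apply: mulr_ge0; [exact: ltW|apply: divr_ge0; [have := pi0; lra|exact: ltW]].
  have p2 : 0 <= 5 / 12 * (b / N) * pi / mu ^+ 2.
    apply: divr_ge0; last exact: sqr_ge0.
    apply: mulr_ge0; last exact/ltW/pi0.
    by apply: mulr_ge0; [lra|apply: divr_ge0; [lra|exact: ltW]].
  by apply: lerXn2r; rewrite ?nnegrE; lra.
have K : (pi / 2) ^+ 2 = 4 * mu ^+ 2 * tau ^+ 2 by rewrite piE; field.
have mu20 : 0 < mu ^+ 2 by rewrite exprn_gt0.
(* As (pi/2)^2 = 4 mu^2 tau^2, a probability 1/(k mu^2) costs 4/k in units of tau^2. *)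
have kill x k : 0 < k -> x <= (k * mu ^+ 2)^-1 -> (pi / 2) ^+ 2 * x <= 4 / k * tau ^+ 2.
  move=> k0 hx; apply: le_trans (ler_wpM2l _ hx) _; first exact: sqr_ge0.
  rewrite K le_eqVlt; apply/orP; left; apply/eqP.
  by field; rewrite !gt_eqF.
have := kill d2 100 (ltac:(lra)) h2; have := kill d3 10 (ltac:(lra)) h3.
have := kill e 100 (ltac:(lra)) he; have := sqr_ge0 tau.
move: g3; rewrite (exprMn 2 tau) (mulrDr _ d2).
set A := (_ / 2 + _) ^+ 2; move: (tau ^+ 2) (_ * d2) (_ * d3) (_ * e) A => t D2 D3 D A.
by lra.
Qed.

Let bN_le : b / N <= 1 / 1200.
Proof.
rewrite ler_pdivrMr //; have h : 0 <= b * (mu - 100).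
  by apply: mulr_ge0; rewrite ?subr_ge0 // (le_trans ler01 b1).
by have := bN; lra.
Qed.

Let bNpi : 0 <= b / N * pi <= pi / 1200.
Proof.
rewrite mulr_ge0 ?divr_ge0 ?(ltW N0) ?(ltW pi0) ?(le_trans ler01 b1) //=.
by have := ler_wpM2r (ltW pi0) bN_le; lra.
Qed.

Let mesh_le : pi / 2 / M <= pi / 1000.
Proof.
rewrite ler_pdivrMr //; have h : 1000 <= M by have := M_mu; have := mu100; lra.
by have := ler_wpM2l (ltW pi0) h; have := pi0; lra.
Qed.

Lemma radius_minmargin : 0 <= 5 / 12 * (b / N) * pi / mu ^+ 2 /\
  5 / 12 * (b / N) * pi / mu ^+ 2 + pi / 2 / M < pi / 4.
Proof.
have /andP[h1 h2] := bNpi; have hp := pi0; have hm := mesh_le.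
rewrite -[5 / 12 * _ * pi]mulrA; move: (b / N * pi) h1 h2 => x h1 h2.
have mu2 : 1 <= mu ^+ 2 by have := sqr_ge0 (mu - 100); have := mu100; lra.
have h : x / mu ^+ 2 <= x by rewrite ler_pdivrMr ?ler_peMr //; lra.
have h' : 0 <= x / mu ^+ 2 by apply: divr_ge0 => //; lra.
by rewrite -mulrA; move: (x / mu ^+ 2) h h' => y h h'; split; lra.
Qed.

Lemma radius_margin : 0 <= pi * b / N /\ pi * b / N + pi / 2 / M < pi / 4.
Proof.
have /andP[h1 h2] := bNpi; have hp := pi0; have hm := mesh_le.
by rewrite -mulrA [pi * _]mulrC; split; lra.
Qed.

End Budget.

(** * Probabilities of the exceptional events *)

Section TailNumerics.
Variables (R : realType) (m n B : nat) (M : R).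
Local Notation mu := (m%:R : R).
Local Notation b := (B%:R : R).
Local Notation N := (n%:R : R).
Hypothesis m100 : (100 <= m)%N.
Hypothesis nB : (12 * B * m <= n)%N.
Hypothesis hB : 3 * mu ^+ 2 * ln mu <= b.
Hypothesis MN : 100 * N * mu ^+ 2 <= M.

Lemma mu_ge100 : 100 <= mu.
Proof. by rewrite (ler_nat R 100). Qed.

Lemma ln_mu_ge1 : 1 <= ln mu.
Proof.
have mu100 := mu_ge100.
rewrite -ler_expR lnK ?posrE; last by lra.
have -> : 1 = 2%:R * (1 / 2) :> R by lra.
rewrite expRM_natl -[expR _]invrK -expRN exprVn.
have : 1 + - (1 / 2) <= expR (- (1 / 2)) :> R := expR_ge1Dx _.
set e := expR _ => he; apply: (@le_trans _ _ 4); last by lra.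
rewrite -[leRHS]invrK lef_pV2 ?posrE ?exprn_gt0 ?invr_gt0 //; try lra.
by rewrite expr2; nra.
Qed.

Lemma b_ge : 1000 * ln mu <= b /\ 1000 <= b.
Proof.
have mu100 := mu_ge100; have l1 := ln_mu_ge1.
have h : 1000 <= 3 * mu ^+ 2 by have := sqr_ge0 (mu - 100); lra.
have h1 : 1000 * ln mu <= b.
  by apply: le_trans hB; apply: ler_wpM2r; lra.
by split; lra.
Qed.

Lemma N_ge : 12 * b * mu <= N.
Proof. by rewrite -!natrM ler_nat. Qed.

(** The m^2 balls hold at most about 5/6 b candidates on average, so the left side is at most
    e^(0.17 b), while (6/5)^B >= e^(0.173 b). *)
Lemma tail_many : (1 + 5^-1 * (mu ^+ 2 *
    (2 * (5 / 12 * (b / N) * pi / mu ^+ 2 + pi / 2 / M * 2) / pi))) ^+ n <=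
  expR (- (3 / 1000) * b) * (6 / 5) ^+ B.
Proof.
have mu100 := mu_ge100; have [_ hb] := b_ge; have hN := N_ge.
have bmu : b <= b * mu by rewrite ler_peMr; lra.
have N0 : 0 < N by lra.
have mu20 : 0 < mu ^+ 2 by rewrite exprn_gt0; lra.
have M0 : 0 < M.
  by apply: lt_le_trans MN; apply: mulr_gt0; [apply: mulr_gt0; lra|exact: mu20].
have p0 := pi_gt0 R.
have -> : mu ^+ 2 * (2 * (5 / 12 * (b / N) * pi / mu ^+ 2 + pi / 2 / M * 2) / pi) =
    5 / 6 * (b / N) + 2 * (mu ^+ 2 / M) by field; rewrite !gt_eqF //; lra.
have bN0 : 0 < b / N by apply: divr_gt0; lra.
have h : mu ^+ 2 / M <= 1 / 1000 * (b / N).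
  rewrite mulrA ler_pdivlMr // mulrAC ler_pdivrMr //.
  by have := MN; nra.
have mM : 0 <= mu ^+ 2 / M by apply: divr_ge0; exact: ltW.
have h2 : 1 + 5^-1 * (5 / 6 * (b / N) + 2 * (mu ^+ 2 / M)) <= 1 + 17 / 100 * (b / N) by lra.
apply: (@le_trans _ _ ((1 + 17 / 100 * (b / N)) ^+ n)).
  by apply: lerXn2r; rewrite ?nnegrE; lra.
apply: le_trans (exprn_le_expR _ _) _; first by lra.
have eb : N * (b / N) = b by rewrite mulrC divfK // gt_eqF.
have -> : n%:R * (17 / 100 * (b / N)) = - (3 / 1000) * b + B%:R * (173 / 1000).
  by rewrite mulrCA eb; lra.
rewrite expRD expRM_natl; apply: ler_wpM2l; first exact: expR_ge0.
apply: lerXn2r; rewrite ?nnegrE ?expR_ge0; [by []|lra|exact: expR_173_le].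
Qed.

Lemma tail_many_le : expR (- (3 / 1000) * b) <= (100 * mu ^+ 2)^-1.
Proof.
have mu100 := mu_ge100; have [hb _] := b_ge; have l1 := ln_mu_ge1.
have mu0 : 0 < mu by lra.
apply: (@le_trans _ _ (expR (- (3%:R * ln mu)))); first by rewrite ler_expR; lra.
rewrite expRN expRM_natl lnK ?posrE // lef_pV2 ?posrE ?mulr_gt0 ?exprn_gt0 //.
by rewrite exprS; apply: ler_wpM2r => //; exact: sqr_ge0.
Qed.

(** One ball holds 5/6 b/mu^2 candidates on average, at least 5/2 ln mu by the lower bound on B. *)
Lemma tail_none : (1 - 2 * (5 / 12 * (b / N) * pi / mu ^+ 2) / pi) ^+ n <=
  expR (- (5 / 2 * ln mu)).
Proof.
have mu100 := mu_ge100; have [_ hb] := b_ge; have hN := N_ge; have l1 := ln_mu_ge1.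
have bmu : b <= b * mu by rewrite ler_peMr; lra.
have N0 : 0 < N by lra.
have mu20 : 0 < mu ^+ 2 by rewrite exprn_gt0; lra.
have p0 := pi_gt0 R.
have -> : 2 * (5 / 12 * (b / N) * pi / mu ^+ 2) / pi = 5 / 6 * (b / N / mu ^+ 2).
  by field; rewrite !gt_eqF //; lra.
have q1 : b / N / mu ^+ 2 <= 1.
  rewrite ler_pdivrMr // ler_pdivrMr // mul1r.
  have : 1 <= mu ^+ 2 by have := sqr_ge0 (mu - 100); lra.
  by move=> h; apply: (@le_trans _ _ N); [lra|rewrite ler_peMl // ltW].
apply: le_trans (exprn_le_expR _ _) _; first by lra.
rewrite ler_expR mulrN lerN2 mulrCA.
have -> : N * (b / N / mu ^+ 2) = b / mu ^+ 2 by field; rewrite !gt_eqF //; lra.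
have : 3 * ln mu <= b / mu ^+ 2 by rewrite ler_pdivlMr // mulrAC.
by lra.
Qed.

(** The surplus factor mu^(1/2), written [h], is at least 10. *)
Lemma tail_none_le : expR (- (5 / 2 * ln mu)) <= (10 * mu ^+ 2)^-1.
Proof.
have mu100 := mu_ge100; have mu0 : 0 < mu by lra.
have -> : 5 / 2 * ln mu = 2%:R * ln mu + 2^-1 * ln mu by lra.
set h := expR (2^-1 * ln mu).
have hh : h ^+ 2 = mu.
  rewrite /h -expRM_natl (_ : 2%:R * _ = ln mu); last by lra.
  by rewrite lnK ?posrE.
have h0 : 0 < h := expR_gt0 _.
have h10 : 10 <= h.
  by rewrite leNgt; apply/negP => h10; move: hh mu100; rewrite expr2; nra.
rewrite expRN expRD expRM_natl lnK ?posrE // lef_pV2 ?posrE ?mulr_gt0 ?exprn_gt0 //.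
rewrite -/h. by rewrite mulrC; apply: ler_wpM2l; [exact: sqr_ge0|].
Qed.

(** The factors are at most e^(-b) and e^(0.8 b); the remaining e^(-b/5) is at most 1/(1 + b/5). *)
Lemma tail_few : (1 - (pi * b / N) / pi) ^+ n * 2 ^+ B <= 1 / 100 :> R.
Proof.
have mu100 := mu_ge100; have [_ hb] := b_ge; have hN := N_ge.
have bmu : b <= b * mu by rewrite ler_peMr; lra.
have N0 : 0 < N by lra.
have p0 := pi_gt0 R.
have -> : pi * b / N / pi = b / N by rewrite mulrAC [pi * b]mulrC mulfK // gt_eqF.
have bN : b / N <= 1 by rewrite ler_pdivrMr //; lra.
apply: (@le_trans _ _ (expR (- b) * expR (8 / 10 * b))).
  apply: ler_pM.
  - by apply: exprn_ge0; lra.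
  - exact: exprn_ge0.
  - apply: le_trans (exprn_le_expR _ _) _; first by lra.
    by rewrite mulrN mulrC divfK ?gt_eqF.
  - rewrite mulrC expRM_natl.
    by apply: lerXn2r; rewrite ?nnegrE ?expR_ge0; [by []|by []|exact: two_le_expR].
rewrite -expRD.
have -> : - b + 8 / 10 * b = - (2 / 10 * b) by lra.
rewrite expRN.
have : 1 + 2 / 10 * b <= expR (2 / 10 * b) := expR_ge1Dx _.
set e := expR _ => he.
by rewrite -[leRHS]invrK lef_pV2 ?posrE ?invf_div; lra.
Qed.

(** Squaring removes the half-integer exponent: 4^L <= 8^m and 16^m = 8^m 2^m, so 2^m has to exceed
    (100 mu^2)^2. *)
Lemma unmatched_le L : (2 * L <= 3 * m)%N ->
  2 ^+ L * (4 ^+ m)^-1 <= (100 * mu ^+ 2)^-1 :> R.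
Proof.
move=> hL; have mu100 := mu_ge100; have mu0 : 0 < mu by lra.
have w0 : 0 < 100 * mu ^+ 2 by rewrite mulr_gt0 // exprn_gt0.
rewrite ler_pdivrMr ?exprn_gt0 // mulrC ler_pdivlMr //.
have p1 : 0 <= 2 ^+ L * (100 * mu ^+ 2) by apply: mulr_ge0; [exact: exprn_ge0|exact: ltW].
rewrite -(@ler_pXn2r _ 2) ?nnegrE ?exprn_ge0 //.
have h1 : (2 : R) ^+ L ^+ 2 <= 8 ^+ m.
  rewrite -exprM mulnC (_ : 8 = 2 ^+ 3 :> R); last by ring.
  by rewrite -exprM; apply: ler_weXn2l => //; lra.
have h2 : (4 : R) ^+ m ^+ 2 = 8 ^+ m * 2 ^+ m.
  by rewrite -exprM mulnC exprM -exprMn; congr (_ ^+ _); ring.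
rewrite exprMn h2; apply: ler_pM => //; try exact: exprn_ge0.
have e : (100 * mu ^+ 2) ^+ 2 = 10000 * mu ^+ 4 by ring.
by rewrite e; exact: two_exp_ge.
Qed.

End TailNumerics.

(** * Assembly of the two bounds *)

Lemma sum_margin_low_ge (R : realType) (m M : nat) (r : R) : (0 < M)%N ->
  3 / 4 * (mesh R M ^+ 2 / 4 * (M%:R^-1 ^+ (m + m) *
    \sum_(s : cells m M) ((minf s.1)%:R - (minf s.2)%:R) ^+ 2))
    - 3 * (r + mesh R M * 2) ^+ 2
  <= M%:R^-1 ^+ (m + m) * \sum_(s : cells m M) margin_low r s.
Proof.
move=> M0; set wt := _ ^+ (m + m); set h := mesh R M; set C := (r + _) ^+ 2.
have wt0 : 0 <= wt by rewrite exprn_ge0 // invr_ge0.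
have -> : 3 / 4 * (h ^+ 2 / 4 * (wt * \sum_(s : cells m M)
      ((minf s.1)%:R - (minf s.2)%:R) ^+ 2)) - 3 * C =
    wt * \sum_(s : cells m M) (3 / 4 * phihat R s ^+ 2 - 3 * C).
  have eC : wt * \sum_(s : cells m M) (3 * C) = 3 * C.
    have -> : \sum_(s : cells m M) (3 * C) = #|{: cells m M}|%:R * (3 * C).
      by rewrite sumr_const [RHS]mulr_natl.
    by rewrite mulrCA mulrA (card_cells_weight R m M0 : _ * wt = 1) mul1r.
  rewrite sumrB mulrBr eC; congr (_ - _).
  by rewrite !mulr_sumr; apply: eq_bigr => s _; rewrite /phihat -/h; field.
(* Cutting at 0 only raises each term. *)
apply: ler_wpM2l => //; apply: ler_sum => s _.
by rewrite /margin_low le_max lexx orbT.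
Qed.


Lemma half_bounds k : (k <= (2 * k./2).+1)%N /\ (2 * k./2 <= k)%N.
Proof. by have := odd_double_half k; case: odd => /=; lia. Qed.

Theorem theorem1 (R : realType) (d : measure_display) (Omega : measurableType d)
  (P : probability Omega R) (m n B : nat) (beta : R)
  (X Y : 'I_m -> Omega -> R) (Z : 'I_n -> Omega -> R)
  (H : tset R -> pt2 R) :
  (100 <= m)%N ->
  (12 * B * m <= n)%N ->
  3 * (m%:R) ^+ 2 * ln (m%:R) <= (B%:R : R) ->
  (m%:R)^-1 <= beta ->
  is_svm_learner H ->
  (forall i, uniform_law P (X i) 0 (pi / 2)) ->
  (forall i, uniform_law P (Y i) (- (pi / 2)) 0) ->
  (forall j, uniform_law P (Z j) (- (pi / 2)) (pi / 2)) ->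
  mutually_independent P (join3 X Y Z) ->
  (\int[P]_w Theta_star (fun j => Z j w)
      (minmargin_batch H (Num.truncn (beta * m%:R)) B
         (fun i => X i w) (fun i => Y i w) (fun j => Z j w))
   < \int[P]_w Theta_star (fun j => Z j w)
      (margin_batch H B (fun i => X i w) (fun i => Y i w) (fun j => Z j w)))%E.
Proof.
move=> m100 nB hB hbeta svmH unifX unifY unifZ indep.
have mu100 := mu_ge100 R m100; have [_ b1000] := b_ge m100 hB.
have bN := N_ge R nB.
set b : R := B%:R in b1000 bN; set mu : R := m%:R in mu100 bN.
have b1 : 1 <= b by lra.
have p0 := pi_gt0 R.
have m0 : (0 < m)%N by apply: leq_trans m100.
have B0 : (0 < B)%N by rewrite -(ltr0n R); lra.
have n0 : (0 < n)%N by apply: leq_trans nB; rewrite !muln_gt0 B0 m0.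
(* About 3m/2 bins of q mesh intervals each; q is large enough for the mesh condition 100 n m^2 <=
   M. *)
pose L := ((3 * m)./2)%N; pose q := (100 * n * m ^ 2)%N; pose M := (q * L)%N.
have L0 : (0 < L)%N.
  by rewrite half_gt0 mulnC; apply: (leq_trans _ (leq_mul m0 (leqnn 3))).
have q0 : (0 < q)%N by rewrite /q !muln_gt0 n0 m0.
have M0 : (0 < M)%N by rewrite /M muln_gt0 q0 L0.
have ML : M%:R = q%:R * L%:R :> R by rewrite /M natrM.
have MN : 100 * n%:R * mu ^+ 2 <= M%:R :> R.
  by rewrite -natrX -!natrM ler_nat /M leq_pmulr.
have [hL' hL2] := half_bounds (3 * m).
have hL : 3 * mu <= 2 * L%:R + 1 :> R by rewrite -!natrM natr1 ler_nat.
(* beta >= 1/m leaves at least one example per class in a bootstrap sample. *)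
have k0 : (0 < Num.truncn (beta * m%:R))%N.
  by rewrite truncn_gt0 -ler_pdivrMr ?div1r //; lra.
(* Radius for min-margin sampling: the m^2 balls together hold at most 5/6 B candidates on average,
   below the batch size. *)
have [rho0 rho_lt] := radius_minmargin mu100 b1 bN MN.
(* Radius for margin sampling: the ball holds 2B candidates on average, above the batch size. *)
have [r0 r_lt] := radius_margin mu100 b1 bN MN.
have unmatched : #|[pred s : cells m M | ~~ matched q s]|%:R * M%:R^-1 ^+ (m + m)
    <= (100 * mu ^+ 2)^-1.
  apply: le_trans (unmatched_le R m100 hL2).
  have := card_unmatched_le m0 (erefl M) q0.
  rewrite -(ler_nat R) natrM [leRHS]natrM !natrX => h.
  have Mp : 0 < M%:R ^+ (m + m) :> R by rewrite exprn_gt0 // ltr0n.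
  by rewrite exprVn ler_pdivlMr ?exprn_gt0 // mulrAC ler_pdivrMr.
have upper := minmargin_integral_le unifX unifY unifZ indep svmH M0 m0 n0 B0 q0 k0 rho0
  rho_lt
  (tail_many m100 nB hB MN) (tail_none m100 nB hB).
have ub := budget_minmargin mu100 b1 bN MN ML hL (tail_many_le m100 hB)
  (tail_none_le R m100) unmatched.
have lower := margin_integral_ge unifX unifY unifZ indep svmH M0 m0 r0
  r_lt (tail_few m100 nB hB).
have sq := sum_minf_diff_sq m0 R M0.
have eq1 : m.+1%:R = mu + 1 by rewrite natr1.
have eq2 : m.+2%:R = mu + 2 by rewrite -(natrD R m 2) addn2.
rewrite eq1 eq2 in sq.
have lb := budget_margin mu100 b1 bN MN (budget_second_moment mu100 b1 bN MN sq).
have tau0 : 0 < (pi / (4 * mu)) ^+ 2.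
  by rewrite exprn_gt0 // divr_gt0 // mulr_gt0 // ltr0n.
apply: le_lt_trans upper _; apply: lt_le_trans lower; rewrite lte_fin.
(* The two sides are separated by 0.95 tau^2 < 1.06 tau^2. *)
apply: le_lt_trans ub _; apply: lt_le_trans (_ : 106 / 100 * (pi / (4 * mu)) ^+ 2 <= _).
  by move: tau0; clear; move: (_ ^+ 2) => t t0; lra.
apply: (le_trans lb).
have [c c0] : 1 - 1 / 100 = 99 / 100 :> R /\ (0 : R) <= 99 / 100 by clear; split; lra.
rewrite c; apply: ler_wpM2l; first exact: c0.
exact: (sum_margin_low_ge m _ M0).
Qed.
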